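(* Let $n\in\mathbb{N}$, let $\alpha_0,\dots,\alpha_n\in[0,\infty)$ be real numbers with $\alpha_0=0<\alpha_1<\dots<\alpha_n$, and let $\mathcal{F}=\{x^{\alpha_i}\}_{i=0}^n$ on $[0,\infty)$. Then for any $f=\sum_{i=0}^n a_i x^{\alpha_i}\in\operatorname{lin}\mathcal{F}$ with $f>0$ on $[0,\infty)$ and $a_n>0$ there exists a unique decomposition $$f=f_*+f^*$$ with $f_*,f^*\in\operatorname{lin}\mathcal{F}$ and $f_*,f^*\ge 0$ on $[0,\infty)$ such that the following hold: (i) If $n=2m$, then the polynomials $f_*$ and $f^*$ each possess $m$ distinct zeros, $\{x_i\}_{i=1}^m$ and $\{y_i\}_{i=0}^{m-1}$, satisfying $$0=y_0<x_1<y_1<\dots<y_{m-1}<x_m<\infty.$$ The polynomials $f_*$ and $f^*$ are given by $$f_*(x)=a_{2m}\cdot\det\begin{pmatrix} 1&x^{\alpha_1}&x^{\alpha_2}&\dots&x^{\alpha_{2m-1}}&x^{\alpha_{2m}}\\ x&(x_1&x_1)&\dots&(x_m&x_m)\end{pmatrix}$$ and $$f^*(x)=c\cdot\det\begin{pmatrix} x^{\alpha_1}&x^{\alpha_2}&x^{\alpha_3}&\dots&x^{\alpha_{2m-2}}&x^{\alpha_{2m-1}}\\ x&(y_1&y_1)&\dots&(y_{m-1}&y_{m-1})\end{pmatrix}$$ for some $c>0$. (ii) If $n=2m+1$, then $f_*$ and $f^*$ have zeros $\{x_i\}_{i=1}^{m+1}$ and $\{y_i\}_{i=1}^m$, respectively,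 which satisfy $$0=x_1<y_1<x_2<\dots<y_m<x_{m+1}<\infty.$$ The polynomials $f_*$ and $f^*$ are given by $$f_*(x)=a_{2m+1}\cdot\det\begin{pmatrix} x^{\alpha_1}&x^{\alpha_2}&x^{\alpha_3}&\dots&x^{\alpha_{2m}}&x^{\alpha_{2m+1}}\\ x&(x_2&x_2)&\dots&(x_{m+1}&x_{m+1})\end{pmatrix}$$ and $$f^*(x)=c\cdot\det\begin{pmatrix} 1&x^{\alpha_1}&x^{\alpha_2}&\dots&x^{\alpha_{2m-1}}&x^{\alpha_{2m}}\\ x&(y_1&y_1)&\dots&(y_m&y_m)\end{pmatrix}$$ for some $c>0$.
   Context: $\operatorname{lin}\mathcal{F}$ is the real vector space of linear combinations of the functions in $\mathcal{F}$ (its elements are called polynomials); $x^0=1$ is the constant function. Matrix notation: for functions $g_0,\dots,g_k$ and points $z_0,\dots,z_k$, $\begin{pmatrix} g_0&\dots&g_k\\ z_0&\dots&z_k\end{pmatrix}$ denotes the $(k+1)\times(k+1)$ matrix whose row belonging to the point $z_j$ is $(g_0(z_j),\dots,g_k(z_j))$. A bracketed pair $(z\ \ z)$ in the bottom line stands for two consecutive rows: $(g_0(z),\dots,g_k(z))$ followed by the row of derivatives $(g_0'(z),\dots,g_k'(z))$. In the top line $x^{\alpha_i}$ denotes the function $t\mapsto t^{\alpha_i}$; the bottom-line entry $x$ is the variable point at which $f_*$ or $f^*$ is evaluated.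
   Formalization: The printed formulas for f_* fail in general (e.g. α=(0,2,4), f=x^4-2x^2+2); the determinant in f_* is here divided by its coefficient of x^{α_n}, so that f_* has leading coefficient a_n. N starts at 1. *)

(* Defs.v *)
(* MathComp-Analysis; the reals are an arbitrary [R : realType]. *)
From HB Require Import structures.
From mathcomp Require Import all_boot all_order all_algebra.
From mathcomp Require Import all_classical all_reals all_analysis.

Set Implicit Arguments.
Unset Strict Implicit.
Unset Printing Implicit Defensive.

Import Order.TTheory GRing.Theory Num.Theory.
Import numFieldNormedType.Exports.

Local Open Scope ring_scope.

(* Finite families a_0, ..., a_n are written as [a : nat -> R]; only the
   indices named below are ever read.  All functions are considered on
   [0, oo): values at negative arguments are never used, and two functions are
   identified when they agree on [0, oo). *)

(* [t `^ 0 = 1] for every t, including t = 0, and [0 `^ b = 0] for b != 0. *)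
Definition lincomb (R : realType) (n : nat) (alpha a : nat -> R) (t : R) : R :=
  \sum_(i < n.+1) a i * t `^ alpha i.

Definition in_lin (R : realType) (n : nat) (alpha : nat -> R) (g : R -> R)
    : Prop :=
  exists b : nat -> R, forall t : R, 0 <= t -> g t = lincomb n alpha b t.

(* The matrix
     ( t^(al 0)  t^(al 1)  ...  t^(al (2r)) )
     (    x     (z_1 z_1)  ...   (z_r z_r)  )
   Row 0 belongs to x; rows 2j-1 and 2j (1 <= j <= r) are the values and the
   derivatives at z_j.  [z 0] is not used. *)
Definition confluent_mx (R : realType) (r : nat) (al z : nat -> R) (x : R)
    : 'M[R]_(r.*2.+1) :=
  \matrix_(i, j)
    if i == 0 :> nat then x `^ al j
    else if odd i then z (uphalf i) `^ al j
    else derive1 (fun t : R => t `^ al j) (z i./2).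

(* The coefficient of t^(al (2r)) in the polynomial
   x |-> \det (confluent_mx r al z x): the cofactor of the top right entry.
   It does not depend on x, since row 0 is deleted. *)
Definition confluent_lead (R : realType) (r : nat) (al z : nat -> R) (x : R)
    : R :=
  cofactor (confluent_mx r al z x) ord0 ord_max.

(* n = 2m, with gl = f_* and gu = f^*.

   The factor [a_n / confluent_lead] rather than [a_n]: f^* has no
   x^(alpha n) term, so f = f_* + f^* forces the leading coefficient of f_* to
   be a_n; the determinant alone has leading coefficient [confluent_lead],
   which is not 1 in general, so it is normalized. *)
Definition even_form (R : realType) (m : nat) (alpha a : nat -> R)
    (gl gu : R -> R) : Prop :=
  exists x y : nat -> R,
    [/\ y 0%N = 0,
        (forall i : nat, (0 < i <= m)%N -> y i.-1 < x i),
        (forall i : nat, (0 < i < m)%N -> x i < y i),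
        (forall t : R, 0 <= t ->
           (gl t = 0 <-> exists2 i : nat, (0 < i <= m)%N & t = x i) /\
           (gu t = 0 <-> exists2 i : nat, (i < m)%N & t = y i)) &
        (forall t : R, 0 <= t ->
           gl t = a m.*2 / confluent_lead m alpha x t
                  * \det (confluent_mx m alpha x t)) /\
        (exists2 c : R, 0 < c & forall t : R, 0 <= t ->
           gu t = c * \det (confluent_mx m.-1 (fun j => alpha j.+1) y t))].

(* n = 2m + 1; same normalization as in [even_form]. *)
Definition odd_form (R : realType) (m : nat) (alpha a : nat -> R)
    (gl gu : R -> R) : Prop :=
  exists x y : nat -> R,
    [/\ x 1%N = 0,
        (forall i : nat, (0 < i <= m)%N -> x i < y i),
        (forall i : nat, (0 < i <= m)%N -> y i < x i.+1),
        (forall t : R, 0 <= t ->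
           (gl t = 0 <-> exists2 i : nat, (0 < i <= m.+1)%N & t = x i) /\
           (gu t = 0 <-> exists2 i : nat, (0 < i <= m)%N & t = y i)) &
        (forall t : R, 0 <= t ->
           gl t = a m.*2.+1
                  / confluent_lead m (fun j => alpha j.+1) (fun j => x j.+1) t
                  * \det (confluent_mx m (fun j => alpha j.+1)
                                         (fun j => x j.+1) t)) /\
        (exists2 c : R, 0 < c & forall t : R, 0 <= t ->
           gu t = c * \det (confluent_mx m alpha y t))].

Definition is_decomposition (R : realType) (n : nat) (alpha a : nat -> R)
    (gl gu : R -> R) : Prop :=
  [/\ in_lin n alpha gl /\ in_lin n alpha gu,
      (forall t : R, 0 <= t -> 0 <= gl t /\ 0 <= gu t),
      (forall t : R, 0 <= t -> lincomb n alpha a t = gl t + gu t),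
      (forall m : nat, n = m.*2 -> even_form m alpha a gl gu) &
      (forall m : nat, n = m.*2.+1 -> odd_form m alpha a gl gu)].

(* Main.v *)
Require Import Defs.
From HB Require Import structures.
From mathcomp Require Import all_boot all_order all_algebra.
From mathcomp Require Import all_classical all_reals all_analysis.
From mathcomp Require Import ring lra zify.

Set Implicit Arguments.
Unset Strict Implicit.
Unset Printing Implicit Defensive.

Import Order.TTheory GRing.Theory Num.Theory.
Import numFieldNormedType.Exports.

Local Open Scope ring_scope.

(** Write f_* = (f + p) / 2 and f^* = (f - p) / 2.  Both are nonnegative exactly
    when |p| <= f, a zero of f_* is a point with p = - f, and a zero of f^* is a
    point with p = f.  So the decomposition amounts to a polynomial p that
    alternates between f and - f at n + 1 points, the first being 0 and the last
    being oo, where p = f means that p has the leading coefficient a_n.  To make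
    oo an ordinary point, a polynomial is replaced by [homog], a continuous
    function on [0, 1] whose value at 1 is the leading coefficient.

    Everything rests on Descartes' rule of signs ([lincomb_zeros],
    [homog_double_zeros]): a polynomial with k nonzero coefficients has at most
    k - 1 zeros inside, double zeros counted twice.

    Existence.  Among the p with |p| <= f take one with the largest coefficient of
    x^alpha_1; the feasible set is compact ([exists_maximizer]).  If p touched f
    and - f alternately at fewer than n + 1 points, the touching points of
    different sign could be separated by k < n points ([separators]).  There is a
    polynomial q with sign changes at exactly these k points, no other zeros on
    [0, 1], and no term in x^alpha_1 ([exists_sign_pattern]).  Then p - e q stays
    strictly between - f and f ([perturb]), and it can be scaled up to a feasible
    polynomial with a larger coefficient ([maximizer_touching]).  That 0 and oo
    are among the touching points follows by counting the zeros of f - p and f + p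
    ([touching_ends]).  For n = 1 the polynomial is explicit.

    Uniqueness.  Conversely every alternating polynomial is extremal
    ([touching_extremal]).  The mean of two of them is again extremal, so it
    touches at n + 1 points, where both must agree ([alternates_unique]).

    Determinants.  The confluent determinant vanishes doubly at the prescribed
    points, and so does the nonnegative polynomial f_* or f^*; Descartes' bound
    makes them proportional ([det_form]).  Its leading coefficient is a minor,
    positive by adding one row at a time ([det_mono_mx_gt0]); this fixes the
    factors and gives c > 0.  The same bound shows that there are no further
    zeros. *)

(** * Zeros of sums of real powers *)

Definition gpoly (R : realType) (s : seq (R * R)) (t : R) : R :=
  \sum_(p <- s) p.1 * t `^ p.2.

Definition dgpoly (R : realType) (s : seq (R * R)) : seq (R * R) :=
  [seq (p.1 * p.2, p.2 - 1) | p <- s].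

Lemma is_derive_gpoly (R : realType) (s : seq (R * R)) (t : R) :
  0 < t -> is_derive t 1 (gpoly s) (gpoly (dgpoly s) t).
Proof.
move=> t0; elim: s => [|p s IH].
  have -> : gpoly (R:=R) [::] = cst 0 by apply/funext => u; rewrite /gpoly big_nil.
  exact: is_derive_cst.
have -> : gpoly (p :: s) = (p.1 \*: (fun u => u `^ p.2)) + gpoly s.
  by apply/funext => u; rewrite /gpoly big_cons.
have -> : gpoly (dgpoly (p :: s)) t
    = p.1 *: (p.2 * t `^ (p.2 - 1)) + gpoly (dgpoly s) t.
  by rewrite /gpoly /= big_cons /= -mulrA.
apply: is_deriveD; apply: is_deriveZ; exact: is_derive1_powR.
Qed.

Lemma rolle_zeros (R : realType) (f df : R -> R) (z : R) (zs : seq R) :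
    (forall t : R, 0 < t -> is_derive t 1 f (df t)) ->
    0 < z -> path <%R z zs -> (forall x, x \in z :: zs -> f x = 0) ->
  exists ws, [/\ size ws = size zs, uniq ws,
    (forall w, w \in ws -> z < w), (forall w, w \in ws -> w \notin zs)
    & (forall w, w \in ws -> df w = 0)].
Proof.
move=> fdf; elim: zs z => [|y zs IH] z z0 /=; first by exists [::].
move=> /andP[zy yzs] f0; have y0 : 0 < y := lt_trans z0 zy.
have [|ws [sws uws yws wszs dws]] := IH y y0 yzs.
  by move=> x xy; apply: f0; rewrite in_cons xy orbT.
have [||| w /itvP wzy dw] := @Rolle R f z y zy.
- move=> x /itvP xzy; have x0 : 0 < x by rewrite (lt_trans z0) ?xzy.
  by have := fdf x x0 => -[].
- apply: derivable_within_continuous => x /itvP xzy.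
  have x0 : 0 < x by rewrite (lt_le_trans z0) ?xzy.
  by have := fdf x x0 => -[].
- by rewrite !f0 ?in_cons ?eqxx ?orbT.
have zw : z < w by rewrite wzy.
have wy : w < y by rewrite wzy.
exists (w :: ws); split => /=.
- by rewrite sws.
- by rewrite uws andbT; apply/negP => /yws; rewrite ltNge (ltW wy).
- by move=> u; rewrite in_cons => /orP[/eqP->//|/yws yu]; exact: lt_trans yu.
- move=> u; rewrite !in_cons => /orP[/eqP->|uws'].
    rewrite (lt_eqF wy) /=; apply/negP => wzs.
    have : all (> y) zs by apply: order_path_min yzs => a b c; exact: lt_trans.
    by move=> /allP/(_ _ wzs); rewrite ltNge (ltW wy).
  by rewrite negb_or wszs // (gt_eqF (yws _ uws')).
- move=> u; rewrite in_cons => /orP[/eqP->|/dws//].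
  have w0 : 0 < w := lt_trans z0 zw.
  by have [_ <-] := fdf w w0; have [_ <-] := dw.
Qed.

Lemma gpoly_factor (R : realType) (s : seq (R * R)) (e t : R) : 0 < t ->
  gpoly s t = t `^ e * gpoly [seq (p.1, p.2 - e) | p <- s] t.
Proof.
move=> t0; rewrite /gpoly big_map mulr_sumr; apply: eq_bigr => p _ /=.
rewrite mulrCA -powRD; last by rewrite (gt_eqF t0) implybT.
by rewrite addrC subrK.
Qed.

Lemma gpoly_eq0_factor (R : realType) (s : seq (R * R)) (e t : R) : 0 < t ->
  gpoly s t = 0 -> gpoly [seq (p.1, p.2 - e) | p <- s] t = 0.
Proof.
move=> t0; rewrite (gpoly_factor _ e t0) => /eqP; rewrite mulf_eq0.
by rewrite gt_eqF ?powR_gt0 //= => /eqP.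
Qed.

(** Division by t ^ e followed by differentiation, term by term; a term of
    exponent e becomes 0. *)
Definition rolle_step (R : realType) (e : R) (s : seq (R * R)) :=
  [seq (p.1 * (p.2 - e), p.2 - e - 1) | p <- s].

Lemma rolle_step_neq0 (R : realType) (p : R * R) (s : seq (R * R)) :
    all (fun p => p.1 != 0) (p :: s) -> uniq [seq p.2 | p <- p :: s] ->
  all (fun p => p.1 != 0) (rolle_step p.2 s).
Proof.
move=> /= /andP[_ /allP c0] /andP[/negP ps _]; apply/allP => q /mapP[r rs ->] /=.
rewrite mulf_neq0 ?c0 // subr_eq0; apply/negP => /eqP e; apply: ps.
by rewrite -e; apply: map_f.
Qed.

Lemma rolle_step_uniq (R : realType) (e : R) (s : seq (R * R)) :
  uniq [seq p.2 | p <- s] -> uniq [seq p.2 | p <- rolle_step e s].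
Proof.
rewrite -map_comp (_ : _ \o _ = (fun x => x - e - 1) \o snd) // map_comp => us.
by rewrite map_inj_uniq // => x y; lra.
Qed.

Lemma gpoly_rolle_step (R : realType) (e : R) (s : seq (R * R)) (t : R) :
  0 < t -> gpoly (rolle_step e s) t
           = t `^ (- e) * (gpoly (dgpoly s) t - e / t * gpoly s t).
Proof.
move=> t0; rewrite /gpoly /rolle_step /dgpoly !big_map !mulr_sumr -sumrB mulr_sumr.
apply: eq_bigr => p _ /=.
have tP x y : t `^ (x + y) = t `^ x * t `^ y.
  by rewrite powRD // (gt_eqF t0) implybT.
have -> : p.2 - e - 1 = - e + p.2 + (- 1) by lra.
have -> : p.2 - 1 = p.2 + (- 1) by [].
rewrite !tP (powR_inv1 (ltW t0)); ring.
Qed.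

Lemma is_derive_rolle_step (R : realType) (p : R * R) (s : seq (R * R)) (t : R) :
  0 < t -> is_derive t 1 (gpoly [seq (q.1, q.2 - p.2) | q <- p :: s])
    (gpoly (rolle_step p.2 s) t).
Proof.
move=> t0; have := is_derive_gpoly [seq (q.1, q.2 - p.2) | q <- p :: s] t0.
by rewrite {2}/gpoly /= big_cons /= subrr mulr0 mul0r add0r /dgpoly -map_comp.
Qed.

Lemma gpoly_rolle (R : realType) (p : R * R) (s : seq (R * R)) (z : R)
    (zs : seq R) :
    0 < z -> path <%R z zs -> (forall x, x \in z :: zs -> gpoly (p :: s) x = 0) ->
  exists ws, [/\ size ws = size zs, uniq ws,
    (forall w, w \in ws -> z < w), (forall w, w \in ws -> w \notin zs)
    & (forall w, w \in ws -> gpoly (rolle_step p.2 s) w = 0)].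
Proof.
move=> z0 zzs g0.
apply: (rolle_zeros (fun t => @is_derive_rolle_step R p s t) z0 zzs).
move=> x xz; apply: gpoly_eq0_factor (g0 _ xz).
move: xz; rewrite in_cons => /orP[/eqP->//|xzs].
have /allP/(_ x xzs) : all (> z) zs by apply: order_path_min zzs; exact: lt_trans.
exact: lt_trans.
Qed.

(** Induction on the number of terms: each application of Rolle's theorem costs
    one zero and one term. *)
Lemma gpoly_zeros_sorted (R : realType) (s : seq (R * R)) (z : R) (zs : seq R) :
    s != [::] -> all (fun p => p.1 != 0) s -> uniq [seq p.2 | p <- s] ->
    0 < z -> path <%R z zs -> (forall x, x \in z :: zs -> gpoly s x = 0) ->
  ((size zs).+1 < size s)%N.
Proof.
have [k] := ubnP (size s); elim: k s z zs => // k IH [//|p s] z zs /=.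
rewrite ltnS => sk _ c0 us z0 zzs g0.
have [ws [sws uws zws _ dws]] := gpoly_rolle z0 zzs g0.
have c0' := rolle_step_neq0 c0 us.
have us' := rolle_step_uniq p.2 (proj2 (andP us)).
rewrite ltnS -sws; case: s => [|q s] /= in sk c0 us g0 dws c0' us' *.
  have : gpoly [:: p] z = 0 by apply: g0; rewrite mem_head.
  rewrite /gpoly big_seq1 => /eqP; rewrite mulf_eq0 (gt_eqF (powR_gt0 _ z0)) orbF.
  by case/andP: c0 => /negPf->.
have [->//|ws0] := eqVneq ws [::].
have : sorted <%R (sort <=%R ws) by rewrite sort_lt_sorted.
have : perm_eq (sort <=%R ws) ws by rewrite perm_sort.
case: (sort _ _) => [|v vs] pvs.
  by move: (perm_size pvs) ws0 => /esym/eqP; rewrite size_eq0 => /eqP->.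
rewrite /= => vvs; rewrite -(perm_size pvs) /=.
have h x : x \in v :: vs -> x \in ws by rewrite (perm_mem pvs).
apply: leq_trans (IH (rolle_step p.2 (q :: s)) v vs _ _ _ _ _ vvs _) _ => //=.
- by rewrite /rolle_step /= ?size_map.
- by rewrite (lt_trans z0) // zws // h // mem_head.
- by move=> x xv; apply: dws; apply: h.
- by rewrite /rolle_step /= ?size_map.
Qed.

Lemma gpoly_zeros (R : realType) (s : seq (R * R)) (zs : seq R) :
    s != [::] -> all (fun p => p.1 != 0) s -> uniq [seq p.2 | p <- s] ->
    uniq zs -> (forall x, x \in zs -> 0 < x /\ gpoly s x = 0) ->
  (size zs < size s)%N.
Proof.
move=> s0 c0 us uzs g0.
have : sorted <%R (sort <=%R zs) by rewrite sort_lt_sorted.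
have : perm_eq (sort <=%R zs) zs by rewrite perm_sort.
case: (sort _ _) => [|v vs] pvs.
  by rewrite -(perm_size pvs) /=; case: s s0 {c0 us g0}.
rewrite /= => vvs; rewrite -(perm_size pvs) /=.
have h x : x \in v :: vs -> x \in zs by rewrite (perm_mem pvs).
apply: (gpoly_zeros_sorted s0 c0 us _ vvs).
  by have [] := g0 v (h _ (mem_head _ _)).
by move=> x /h/g0[].
Qed.

(** Rolle's theorem puts zeros of the differentiated quotient strictly between
    consecutive zeros, so the double zeros come on top of these, and one term has
    disappeared. *)
Lemma gpoly_double_zeros (R : realType) (s : seq (R * R)) (zs ds : seq R) :
    s != [::] -> all (fun p => p.1 != 0) s -> uniq [seq p.2 | p <- s] ->
    uniq zs -> uniq ds -> {subset ds <= zs} ->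
    (forall x, x \in zs -> 0 < x /\ gpoly s x = 0) ->
    (forall x, x \in ds -> gpoly (dgpoly s) x = 0) ->
  (size zs + size ds < size s)%N.
Proof.
case: s => [//|p s] s0 c0 us uzs uds dszs g0 d0.
have : sorted <%R (sort <=%R zs) by rewrite sort_lt_sorted.
have : perm_eq (sort <=%R zs) zs by rewrite perm_sort.
case: (sort _ _) => [|v vs] pvs.
  rewrite -(perm_size pvs) add0n; case: ds uds dszs d0 => //= d ds _ /(_ d).
  by rewrite mem_head -(perm_mem pvs) => /(_ isT).
rewrite /= => vvs; rewrite -(perm_size pvs) /=.
have h x : (x \in v :: vs) = (x \in zs) by rewrite (perm_mem pvs).
have v0 : 0 < v by have [] := g0 v; rewrite -?h ?mem_head.
have gv x : x \in v :: vs -> gpoly (p :: s) x = 0 by rewrite h => /g0[].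
have [ws [sws uws vws wvs dws]] := gpoly_rolle v0 vvs gv.
have dr d : d \in ds -> gpoly (rolle_step p.2 s) d = 0.
  move=> dd; have [dp gd] := g0 _ (dszs _ dd).
  have := gpoly_rolle_step p.2 (p :: s) dp.
  rewrite gd d0 // mulr0 subr0 mulr0 => <-.
  by rewrite /gpoly /= big_cons subrr mulr0 mul0r add0r.
have c0' := rolle_step_neq0 c0 us.
have us' := rolle_step_uniq p.2 (proj2 (andP us)).
rewrite addSn ltnS -sws -size_cat -(size_map (fun q => (q.1 * (q.2 - p.2), q.2 - p.2 - 1))).
have [s_nil|s_neq0] := eqVneq s [::].
  (* a single term has no zeros at all *)
  move: (gpoly_zeros_sorted s0 c0 us v0 vvs gv); by rewrite s_nil.
apply: gpoly_zeros => //.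
- by rewrite -size_eq0 size_map size_eq0.
- rewrite cat_uniq uws uds andbT /=; apply/hasPn => d dd; apply/negP => dws'.
  have := wvs _ dws'; have := vws _ dws'; have := dszs _ dd.
  by rewrite -h in_cons => /orP[/eqP->|->//]; rewrite ltxx.
- move=> x; rewrite mem_cat => /orP[xw|xd].
    by rewrite (lt_trans v0) ?vws // dws.
  by have [] := g0 _ (dszs _ xd); rewrite dr.
Qed.
(** * Descartes' bound for the polynomials of the system *)

Definition supp (R : realType) (n : nat) (b : nat -> R) : nat :=
  #|[pred i : 'I_n.+1 | b i != 0]|.

Definition dlincomb (R : realType) (n : nat) (alpha b : nat -> R) (t : R) : R :=
  \sum_(i < n.+1) b i * (alpha i * t `^ (alpha i - 1)).

Lemma norm1_sqr (R : realType) (k : R) : `|k| = 1 -> k * k = 1.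
Proof.
by move=> k1; rewrite -expr2 -[k ^+ 2]real_normK ?num_real // k1 expr1n.
Qed.

Lemma incr_lt (R : realType) (n : nat) (alpha : nat -> R) :
    (forall i, (i < n)%N -> alpha i < alpha i.+1) ->
  forall i j, (i < j)%N -> (j <= n)%N -> alpha i < alpha j.
Proof.
move=> incr i; elim=> // j IH; rewrite ltnS leq_eqVlt => /orP[/eqP<-|ij] jn.
  exact: incr.
by apply: lt_trans (incr _ jn); apply: IH => //; exact: ltnW.
Qed.

Lemma incr_le (R : realType) (n : nat) (alpha : nat -> R) :
    (forall i, (i < n)%N -> alpha i < alpha i.+1) ->
  forall i j, (i <= j)%N -> (j <= n)%N -> alpha i <= alpha j.
Proof.
move=> incr i j; rewrite leq_eqVlt => /orP[/eqP->//|ij] jn.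
exact/ltW/(incr_lt incr).
Qed.

Lemma incr_inj (R : realType) (n : nat) (alpha : nat -> R) :
    (forall i, (i < n)%N -> alpha i < alpha i.+1) ->
  injective (fun i : 'I_n.+1 => alpha i).
Proof.
move=> incr i j eij; apply/val_inj => /=.
have [ij|ji|//] := ltngtP i j.
- by have := incr_lt incr ij (leq_ord j); rewrite eij ltxx.
- by have := incr_lt incr ji (leq_ord i); rewrite eij ltxx.
Qed.

Definition terms (R : realType) (n : nat) (alpha b : nat -> R) : seq (R * R) :=
  [seq (b (val i), alpha (val i)) | i <- enum [pred i : 'I_n.+1 | b i != 0]].

Lemma lincomb_gpoly (R : realType) (n : nat) (alpha b : nat -> R) :
  lincomb n alpha b = gpoly (terms n alpha b).
Proof.
apply/funext => t; rewrite /gpoly big_map /= big_enum /= /lincomb big_mkcond /=.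
rewrite [RHS]big_mkcond; apply: eq_bigr => i _; rewrite inE /=.
by case: eqP => [->|//]; rewrite mul0r.
Qed.

Lemma dlincomb_gpoly (R : realType) (n : nat) (alpha b : nat -> R) (t : R) :
  dlincomb n alpha b t = gpoly (dgpoly (terms n alpha b)) t.
Proof.
rewrite /gpoly /dgpoly !big_map big_enum /= /dlincomb big_mkcond /=.
rewrite [RHS]big_mkcond; apply: eq_bigr => i _; rewrite inE /=.
by case: eqP => [->|_]; rewrite ?mul0r //= mulrA.
Qed.

Lemma is_derive_lincomb (R : realType) (n : nat) (alpha b : nat -> R) (t : R) :
  0 < t -> is_derive t 1 (lincomb n alpha b) (dlincomb n alpha b t).
Proof.
by move=> t0; rewrite lincomb_gpoly dlincomb_gpoly; exact: is_derive_gpoly.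
Qed.

(** Descartes' rule of signs.  The bound is by the number of nonzero coefficients
    and not by n, because the arguments below gain from coefficients that are
    made to vanish. *)
Lemma lincomb_zeros (R : realType) (n : nat) (alpha b : nat -> R)
    (zs ds : seq R) :
    (forall i, (i < n)%N -> alpha i < alpha i.+1) ->
    (exists2 i, (i <= n)%N & b i != 0) ->
    uniq zs -> uniq ds -> {subset ds <= zs} ->
    (forall x, x \in zs -> 0 < x /\ lincomb n alpha b x = 0) ->
    (forall x, x \in ds -> dlincomb n alpha b x = 0) ->
  (size zs + size ds < supp n b)%N.
Proof.
move=> incr [i0 i0n bi0] uzs uds dszs z0 d0.
have -> : supp n b = size (terms n alpha b) by rewrite size_map -cardE.
apply: gpoly_double_zeros => //.
- rewrite -size_eq0 size_map -cardE; apply/eqP => /card0_eq/(_ (inord i0)).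
  by rewrite !inE inordK // bi0.
- apply/allP => p /mapP[i]; rewrite mem_enum => bi -> /=; exact: bi.
- rewrite -map_comp map_inj_uniq ?enum_uniq //; exact: incr_inj.
- by move=> x /z0; rewrite lincomb_gpoly.
- by move=> x /d0; rewrite dlincomb_gpoly.
Qed.

(** * Compactification of the half-line *)

(** The substitution t = s / (1 - s) followed by multiplication with
    (1 - s) ^ alpha_n: the point s = 1 plays the role of t = oo, and the value
    there is the leading coefficient.  The absolute values make the function
    continuous on the whole line. *)
Definition homog (R : realType) (n : nat) (alpha b : nat -> R) (s : R) : R :=
  \sum_(i < n.+1) b i * (`|s| `^ alpha i * `|1 - s| `^ (alpha n - alpha i)).

Lemma powR_norm_continuous (R : realType) (e : R) :
  0 <= e -> continuous (fun s : R => `|s| `^ e).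
Proof.
rewrite le_eqVlt => /orP[/eqP<-|e0].
  have -> : (fun s : R => `|s| `^ 0) = cst 1 by apply/funext => s; rewrite powRr0.
  exact: cst_continuous.
move=> s; have [->|s0] := eqVneq s 0.
  apply/cvgrPdist_lt => eps eps0; rewrite normr0 powR0 ?gt_eqF //.
  near=> x; rewrite sub0r normrN ger0_norm ?powR_ge0 //.
  rewrite -[ltRHS](powRr1 (ltW eps0)) -(mulVf (lt0r_neq0 e0)) powRrM.
  apply: gt0_ltr_powR => //; rewrite ?nnegrE ?powR_ge0 //.
  rewrite -[x]subr0 distrC; near: x.
  by apply: (@cvgr_dist_lt _ _ _ (nbhs (0:R)) _ id 0 _ (eps `^ e^-1)); rewrite ?powR_gt0.
have h : continuous_at s (fun x : R => `|x|) by apply: norm_continuous.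
apply: (@continuous_comp _ _ _ (fun x : R => `|x|) (fun x : R => x `^ e) s h).
apply: differentiable_continuous; apply/derivable1_diffP.
by apply: derivable_powR; rewrite in_itv /= andbT normr_gt0.
Unshelve. all: by end_near.
Qed.

Lemma continuous_bigsum (R : realType) (T : topologicalType) (I : Type)
    (r : seq I) (F : I -> T -> R) :
  (forall i, continuous (F i)) -> continuous (fun s => \sum_(i <- r) F i s).
Proof.
move=> cF; elim: r => [|i r IH].
  have -> : (fun s => \sum_(i <- [::]) F i s) = cst 0.
    by apply/funext => s; rewrite big_nil.
  exact: cst_continuous.
have -> : (fun s => \sum_(j <- i :: r) F j s)
    = F i \+ (fun s => \sum_(j <- r) F j s).
  by apply/funext => s; rewrite big_cons.
by move=> s; apply: continuousD; [exact: cF|exact: IH].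
Qed.

Lemma homog_continuous (R : realType) (n : nat) (alpha b : nat -> R) :
    (forall i, (i < n)%N -> alpha i < alpha i.+1) -> 0 <= alpha 0%N ->
  continuous (homog n alpha b).
Proof.
move=> incr a0; apply: continuous_bigsum => i s.
have ai : 0 <= alpha i.
  by apply: le_trans a0 _; apply: (incr_le incr) => //; exact: leq_ord.
have ani : 0 <= alpha n - alpha i.
  by rewrite subr_ge0; apply: (incr_le incr) => //; exact: leq_ord.
apply: (@continuousM R R (cst (b i))
  (fun s => `|s| `^ alpha i * `|1 - s| `^ (alpha n - alpha i)) s).
  exact: cst_continuous.
apply: (@continuousM R R (fun s => `|s| `^ alpha i)
  (fun s => `|1 - s| `^ (alpha n - alpha i)) s).
  exact: powR_norm_continuous.
apply: (@continuous_comp _ _ _ (fun x : R => 1 - x)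
  (fun x : R => `|x| `^ (alpha n - alpha i)) s); last exact: powR_norm_continuous.
by apply: continuousB; [exact: cst_continuous|exact: cvg_id].
Qed.

Lemma homogE (R : realType) (n : nat) (alpha b : nat -> R) (s : R) :
    0 <= s < 1 ->
  homog n alpha b s = (1 - s) `^ alpha n * lincomb n alpha b (s / (1 - s)).
Proof.
move=> /andP[s0 s1]; have s1' : 0 < 1 - s by rewrite subr_gt0.
rewrite /homog /lincomb mulr_sumr; apply: eq_bigr => i _.
rewrite (ger0_norm s0) (gtr0_norm s1') [RHS]mulrCA; congr (_ * _).
rewrite powRM ?invr_ge0 ?(ltW s1') // powRB ?(gt_eqF s1') ?implybT //.
rewrite [RHS]mulrCA; congr (_ * (_ * _)).
by rewrite -[in RHS](powR_inv1 (ltW s1')) -powRrM mulN1r powRN.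
Qed.

Lemma homog1 (R : realType) (n : nat) (alpha b : nat -> R) :
    (forall i, (i < n)%N -> alpha i < alpha i.+1) -> homog n alpha b 1 = b n.
Proof.
move=> incr; rewrite /homog big_ord_recr /= subrr normr0 normr1 !powR1 subrr.
rewrite powRr0 !mulr1 big1 ?add0r // => i _; rewrite powR0 ?mulr0 //.
by rewrite subr_eq0 gt_eqF // (incr_lt incr).
Qed.

Lemma homog0 (R : realType) (n : nat) (alpha b : nat -> R) :
    (forall i, (i < n)%N -> alpha i < alpha i.+1) -> alpha 0%N = 0 ->
  homog n alpha b 0 = b 0%N.
Proof.
move=> incr a0; rewrite /homog big_ord_recl /= subr0 normr0 normr1 !powR1.
rewrite a0 powRr0 !mulr1 big1 ?addr0 // => i _; rewrite powR0 ?mul0r ?mulr0 //.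
by rewrite gt_eqF // -a0 (incr_lt incr) //= /bump; case: i.
Qed.

Lemma homog_lin (R : realType) (n : nat) (alpha b c : nat -> R) (k l s : R) :
  homog n alpha (fun i => k * b i + l * c i) s
  = k * homog n alpha b s + l * homog n alpha c s.
Proof.
rewrite /homog !mulr_sumr -big_split /=; apply: eq_bigr => i _; ring.
Qed.

Lemma homogZ (R : realType) (n : nat) (alpha b : nat -> R) (k s : R) :
  homog n alpha (fun i => k * b i) s = k * homog n alpha b s.
Proof. by rewrite /homog mulr_sumr; apply: eq_bigr => i _; rewrite -!mulrA. Qed.

Lemma homogB (R : realType) (n : nat) (alpha b c : nat -> R) (s : R) :
  homog n alpha (fun i => b i - c i) s = homog n alpha b s - homog n alpha c s.
Proof. by rewrite /homog -sumrB; apply: eq_bigr => i _; rewrite mulrBl. Qed.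

Lemma lincomb_lin (R : realType) (n : nat) (alpha b c : nat -> R) (k l t : R) :
  lincomb n alpha (fun i => k * b i + l * c i) t
  = k * lincomb n alpha b t + l * lincomb n alpha c t.
Proof.
rewrite /lincomb !mulr_sumr -big_split /=; apply: eq_bigr => i _; ring.
Qed.

Lemma lincombB (R : realType) (n : nat) (alpha b c : nat -> R) (t : R) :
  lincomb n alpha (fun i => b i - c i) t = lincomb n alpha b t - lincomb n alpha c t.
Proof. by rewrite /lincomb -sumrB; apply: eq_bigr => i _; rewrite mulrBl. Qed.

Lemma homog_ge0 (R : realType) (n : nat) (alpha b : nat -> R) :
    (forall i, (i < n)%N -> alpha i < alpha i.+1) -> 0 <= alpha 0%N ->
    (forall t, 0 <= t -> 0 <= lincomb n alpha b t) ->
  forall s, 0 <= s <= 1 -> 0 <= homog n alpha b s.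
Proof.
move=> incr a0 g0 s /andP[s0]; rewrite le_eqVlt => /orP[/eqP->|s1]; last first.
  rewrite homogE ?s0 ?s1 // mulr_ge0 ?powR_ge0 // g0 // divr_ge0 // subr_ge0.
  exact: ltW.
(* the value at 1 is a limit of nonnegative values *)
rewrite leNgt; apply/negP => h1.
have c1 : {for 1, continuous (homog n alpha b)} by exact: homog_continuous.
have : \forall s \near (1 : R), homog n alpha b s < 0.
  by have /cvgr_lt/(_ 0 h1) := c1.
move=> /nbhs_ballP[e /= e0 he].
pose d := Num.min (e / 2) 2^-1.
have d0 : 0 < d by rewrite lt_min; apply/andP; split; lra.
have de : d <= e / 2 by rewrite ge_min lexx.
have d2 : d <= 2^-1 by rewrite ge_min lexx orbT.
have := he (1 - d); rewrite /ball /= opprB addrCA subrr addr0 gtr0_norm //.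
have -> : d < e by lra.
move=> /(_ isT); rewrite homogE; last by apply/andP; split; lra.
rewrite ltNge mulr_ge0 ?powR_ge0 // g0 // divr_ge0; lra.
Qed.

Lemma supp_le (R : realType) (n : nat) (b : nat -> R) (A : seq nat) :
    uniq A -> (forall i, i \in A -> (i <= n)%N /\ b i = 0) ->
  (supp n b + size A <= n.+1)%N.
Proof.
move=> uA A0; rewrite /supp -[X in (_ <= X)%N](card_ord n.+1).
rewrite -(cardC [pred i : 'I_n.+1 | b i != 0]) leq_add2l.
have uA' : uniq [seq (inord i : 'I_n.+1) | i <- A].
  rewrite map_inj_in_uniq // => i j /A0[iN _] /A0[jn _].
  by move=> /(congr1 val); rewrite /= !inordK.
rewrite -(size_map (fun i => inord i : 'I_n.+1)) -(card_uniqP uA').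
apply: subset_leq_card; apply/fintype.subsetP => i /mapP[j /A0[jn bj] ->].
by rewrite !inE inordK // bj eqxx.
Qed.

(** * Sign changes of continuous functions *)

Lemma continuous_within (R : realType) (f : R -> R) (a b : R) :
  continuous f -> {within `[a, b], continuous f}%classic.
Proof. by move=> cf; apply: continuous_subspaceT => x; exact: cf. Qed.

Lemma ivt_zero (R : realType) (f : R -> R) (a b : R) :
  continuous f -> a < b -> f a * f b < 0 -> exists2 z, a < z < b & f z = 0.
Proof.
move=> cf ab fab.
have [||z] := @IVT R f a b 0 (ltW ab).
- exact: continuous_within.
- rewrite ge_min le_max; move: fab; rewrite mulr_lt0.
  case: (ltgtP (f a) 0) => //= fa; case: (ltgtP (f b) 0) => //=.
- rewrite in_itv /= => /andP[az zb] fz; exists z => //.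
  rewrite !lt_neqAle az zb !andbT; apply/andP; split; apply/eqP => e.
    by move: fab; rewrite e fz mul0r ltxx.
  by move: fab; rewrite -e fz mulr0 ltxx.
Qed.

Lemma same_sign (R : realType) (f : R -> R) (a b : R) :
    continuous f -> a <= b -> (forall s, a <= s <= b -> f s != 0) ->
  0 < f a * f b.
Proof.
move=> cf; rewrite le_eqVlt => /orP[/eqP<- f0|ab f0].
  by rewrite -expr2 exprn_even_gt0 //= f0 // !lexx.
rewrite lt_neqAle eq_sym mulf_neq0 ?f0 ?lexx ?(ltW ab) //=.
rewrite leNgt; apply/negP => /(ivt_zero cf ab)[z /andP[az zb] fz].
by have := f0 z; rewrite !ltW // fz eqxx => /(_ isT).
Qed.

Lemma alternating_zeros (R : realType) (f : R -> R) (x : R) (ss : seq R) :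
    continuous f -> path (fun u v => (u < v) && (f u * f v < 0)) x ss ->
  exists zs, [/\ size zs = size ss, uniq zs
    & forall z, z \in zs -> [/\ x < z, z < last x ss & f z = 0]].
Proof.
move=> cf; elim: ss x => [|y ss IH] x /=; first by exists [::].
move=> /andP[/andP[xy fxy] /[dup] yss /IH[zs [szs uzs hzs]]].
have [z /andP[xz zy] fz] := ivt_zero cf xy fxy.
have yl : y <= last y ss.
  have /(order_path_min lt_trans) : path <%R y ss.
    by apply: sub_path yss => u v /andP[].
  by case: ss {IH yss szs hzs} => [|u ss] // /allP/(_ (last u ss) (mem_last _ _))/ltW.
exists (z :: zs); split => /=.
- by rewrite szs.
- by rewrite uzs andbT; apply/negP => /hzs[yz _ _]; move: yz; rewrite ltNge (ltW zy).
- move=> w; rewrite in_cons => /orP[/eqP->|/hzs[yw wl fw]]; split => //.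
  + exact: lt_le_trans yl.
  + exact: lt_trans yw.
Qed.

(** Between consecutive points of zs the intermediate value theorem fixes the
    sign, and the last hypothesis forces it to change at each of them. *)
Lemma sign_pattern (R : realType) (f : R -> R) (a b : R) (zs : seq R) :
    continuous f -> a < b -> path <%R a zs -> all (< b) zs ->
    (forall s, a <= s <= b -> s \notin zs -> f s != 0) ->
    (forall z, z \in zs -> forall k l r, l < z < r -> k != 0 ->
       ~ (forall s, l < s < r -> s != z -> 0 < k * f s)) ->
  forall s, a <= s <= b -> s \notin zs ->
    0 < f a * f s * (-1) ^+ count (< s) zs.
Proof.
move=> cf; elim: zs a => [|z zs IH] a ab /=.
  move=> _ _ f0 _ s /andP[as_ sb] _; rewrite mulr1; apply: same_sign => // u.
  by move=> /andP[au us]; apply: f0; rewrite // au (le_trans us).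
move=> /andP[az zzs] /andP[zb zsb] f0 fsc s /andP[as_ sb].
rewrite in_cons negb_or => /andP[sz szs].
have zs_gt : forall u, u \in zs -> z < u.
  by apply/allP; apply: order_path_min zzs; exact: lt_trans.
have fa_lt u : a <= u < z -> 0 < f a * f u.
  move=> /andP[au uz]; apply: same_sign => // v /andP[av vu].
  have vz : v < z by exact: le_lt_trans uz.
  apply: f0; first by rewrite av (ltW (lt_trans vz zb)).
  rewrite in_cons (lt_eqF vz) /=; apply/negP => /zs_gt.
  by rewrite ltNge (ltW vz).
have [sz'|zs'] := ltP s z.
  rewrite (ltNge z) (ltW sz') /= add0n (_ : count _ _ = 0%N) ?mulr1.
    by apply: fa_lt; rewrite as_.
  apply/eqP; rewrite -leqn0 leqNgt -has_count; apply/hasPn => u /zs_gt zu.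
  by rewrite -leNgt (ltW (lt_trans sz' zu)).
have {zs' sz} zs' : z < s by rewrite lt_neqAle eq_sym sz.
(* a' lies behind z and before the next point: induction restarts there *)
pose h := head b zs.
have zh : z < h by rewrite /h; case: (zs) zzs => //= u v /andP[].
have hzs u : u \in zs -> h <= u.
  rewrite /h; case: (zs) zzs => //= v vs /andP[_ vvs]; rewrite in_cons.
  move=> /orP[/eqP->//|]; apply/allP; apply: sub_all (order_path_min lt_trans vvs).
  by move=> w /ltW.
have hb : h <= b by rewrite /h; case: (zs) zsb => //= v vs /andP[/ltW].
pose a' := (z + h) / 2.
have za' : z < a' by rewrite /a'; lra.
have a'h : a' < h by rewrite /a'; lra.
have fa'_gt u : z < u <= a' -> 0 < f u * f a'.
  move=> /andP[zu ua']; apply: same_sign => // v /andP[uv va'].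
  have zv : z < v by exact: lt_le_trans uv.
  apply: f0; first by apply/andP; split; lra.
  rewrite in_cons (gt_eqF zv) /=; apply/negP => /hzs; rewrite leNgt; lra.
have fa0 : f a != 0.
  apply: f0; first by rewrite lexx ltW.
  by rewrite in_cons (lt_eqF az) /=; apply/negP => /zs_gt; lra.
have fa'0 : f a' != 0.
  apply: f0; first by apply/andP; split; lra.
  rewrite in_cons (gt_eqF za') /=; apply/negP => /hzs; lra.
have faa' : f a * f a' < 0.
  rewrite lt_neqAle mulf_neq0 //= leNgt; apply/negP => faa'.
  have azaa' : a < z < a' by rewrite az.
  apply: (fsc z (mem_head _ _) (f a) a a' azaa' fa0).
  move=> u /andP[au ua']; rewrite neq_lt => /orP[uz|zu].
    by apply: fa_lt; rewrite ltW.
  have : 0 < f u * f a' by apply: fa'_gt; rewrite zu ltW.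
  move=> fua'; have : 0 < (f a * f a') * (f u * f a') by exact: mulr_gt0.
  have -> : f a * f a' * (f u * f a') = f a' ^+ 2 * (f a * f u) by ring.
  by rewrite pmulr_rgt0 // exprn_even_gt0.
rewrite zs' /= add1n exprS mulN1r mulrN oppr_gt0.
suff H : 0 < f a' * f s * (-1) ^+ count (< s) zs.
  have : (f a * f a') * (f a' * f s * (-1) ^+ count (< s) zs) < 0.
    by rewrite nmulr_rlt0.
  have -> : f a * f a' * (f a' * f s * (-1) ^+ count (< s) zs)
     = f a' ^+ 2 * (f a * f s * (-1) ^+ count (< s) zs) by ring.
  by rewrite pmulr_rlt0 // exprn_even_gt0.
have [sa'|a's] := ltP s a'.
  rewrite (_ : count _ _ = 0%N) ?mulr1.
    by rewrite mulrC; apply: fa'_gt; rewrite zs' ltW.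
  apply/eqP; rewrite -leqn0 leqNgt -has_count; apply/hasPn => u /hzs zu.
  by rewrite -leNgt; lra.
apply: IH => //.
- lra.
- move: a'h; rewrite {1}/h; case: (zs) zzs => //= v vs /andP[_ ->] ->.
  by [].
- move=> u /andP[a'u ub] uzs; apply: f0; first by apply/andP; split; lra.
  by rewrite in_cons negb_or uzs andbT gt_eqF //; lra.
- by move=> u uzs; apply: fsc; rewrite in_cons uzs orbT.
- by rewrite a's.
Qed.
(** * Zeros on the compactified half-line *)

Definition to_half_line (R : realType) (s : R) : R := s / (1 - s).
Definition of_half_line (R : realType) (t : R) : R := t / (1 + t).

Lemma of_half_lineK (R : realType) (t : R) :
  0 <= t -> to_half_line (of_half_line t) = t.
Proof. by move=> t0; rewrite /to_half_line /of_half_line; field; lra. Qed.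

Lemma to_half_lineK (R : realType) (s : R) :
  s < 1 -> of_half_line (to_half_line s) = s.
Proof. by move=> s1; rewrite /to_half_line /of_half_line; field; lra. Qed.

Lemma of_half_line_lt (R : realType) (s t : R) :
  0 <= t -> s < 1 -> (s < of_half_line t) = (to_half_line s < t).
Proof.
move=> t0 s1; rewrite /to_half_line /of_half_line.
rewrite ltr_pdivlMr ?ltr_pdivrMr; [|lra|lra].
by apply/idP/idP => ?; nra.
Qed.

Lemma lt_of_half_line (R : realType) (s t : R) :
  0 <= t -> s < 1 -> (of_half_line t < s) = (t < to_half_line s).
Proof.
move=> t0 s1; rewrite /to_half_line /of_half_line.
rewrite ltr_pdivlMr ?ltr_pdivrMr; [|lra|lra].
by apply/idP/idP => ?; nra.
Qed.

Lemma of_half_line_itv (R : realType) (t : R) :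
  0 <= t -> 0 <= of_half_line t < 1.
Proof.
move=> t0; rewrite /of_half_line divr_ge0 //=; last lra.
rewrite ltr_pdivrMr; lra.
Qed.

Lemma homog_of_half_line (R : realType) (n : nat) (alpha b : nat -> R) (t : R) :
    0 <= t ->
  homog n alpha b (of_half_line t)
  = (1 - of_half_line t) `^ alpha n * lincomb n alpha b t.
Proof.
move=> t0; rewrite homogE ?of_half_line_itv //.
by have := of_half_lineK t0; rewrite /to_half_line => ->.
Qed.

Lemma of_half_line_gt0 (R : realType) (t e : R) :
  0 <= t -> 0 < (1 - of_half_line t) `^ e.
Proof. by move=> t0; rewrite powR_gt0 // subr_gt0; case/andP: (of_half_line_itv t0). Qed.

Lemma homog_eq0 (R : realType) (n : nat) (alpha b : nat -> R) (s : R) :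
    0 <= s < 1 ->
  (homog n alpha b s == 0) = (lincomb n alpha b (to_half_line s) == 0).
Proof.
move=> s01; have [_ s1] := andP s01.
by rewrite homogE // mulf_eq0 gt_eqF // powR_gt0 // subr_gt0.
Qed.

(** Where the sign does not change, the polynomial on the half-line has a local
    extremum. *)
Lemma homog_touch (R : realType) (n : nat) (alpha b : nat -> R) (k l d r : R) :
    0 < d < 1 -> homog n alpha b d = 0 -> k != 0 -> l < d < r ->
    (forall s, l < s < r -> 0 <= k * homog n alpha b s) ->
  dlincomb n alpha b (to_half_line d) = 0.
Proof.
move=> /andP[d0 d1] hd k0 /andP[ld dr] h.
pose l' := Num.max l (d / 2); pose r' := Num.min r ((1 + d) / 2).
have l'd : l' < d by rewrite gt_max ld; lra.
have dr' : d < r' by rewrite lt_min dr; lra.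
have l'0 : d / 2 <= l' by rewrite le_max lexx orbT.
have r'1 : r' <= (1 + d) / 2 by rewrite ge_min lexx orbT.
have ll' : l <= l' by rewrite le_max lexx.
have rr' : r' <= r by rewrite ge_min lexx.
have tl0 : 0 < to_half_line l' by rewrite divr_gt0; lra.
have tld : to_half_line l' < to_half_line d.
  by rewrite -of_half_line_lt ?to_half_lineK // ?divr_ge0; lra.
have tdr : to_half_line d < to_half_line r'.
  by rewrite -lt_of_half_line ?to_half_lineK // ?divr_ge0; lra.
have tin t : t \in `](to_half_line l'), (to_half_line r')[ ->
    0 < t /\ l' < of_half_line t < r'.
  rewrite in_itv /= => /andP[lt tr]; have t0 : 0 < t by lra.
  by rewrite of_half_line_lt ?lt_of_half_line ?lt ?tr //; lra.
have ld0 : lincomb n alpha b (to_half_line d) = 0.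
  by apply/eqP; rewrite -homog_eq0 ?hd ?eqxx // ltW.
have D (t : R) : 0 < t -> is_derive t 1 (k \*: lincomb n alpha b)
    (k *: dlincomb n alpha b t).
  by move=> t0; apply: is_deriveZ; exact: is_derive_lincomb.
have [||||] := @derive1_at_min R (k \*: lincomb n alpha b)
  (to_half_line l') (to_half_line r') (to_half_line d).
- by rewrite ltW // (lt_trans tld).
- by move=> t /tin[t0 _]; have := D t t0 => -[].
- by rewrite in_itv /= tld.
- move=> t /tin[t0 /andP[lt tr]].
  have -> : (k \*: lincomb n alpha b) (to_half_line d) = 0 :> R.
    by rewrite /= ld0 scaler0.
  have : 0 <= k * homog n alpha b (of_half_line t) by apply: h; apply/andP; split; lra.
  rewrite homog_of_half_line ?(ltW t0) // mulrCA pmulr_rge0 //.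
  by rewrite of_half_line_gt0 // ltW.
- have tD : 0 < to_half_line d by lra.
  have [_ dk] := D _ tD.
  move=> _; rewrite dk => /eqP; rewrite mulf_eq0 (negPf k0) /=.
  by move=> /eqP.
Qed.

Lemma homog_double_zeros (R : realType) (n : nat) (alpha b : nat -> R)
    (zs ds : seq R) :
    (forall i, (i < n)%N -> alpha i < alpha i.+1) ->
    (exists2 i, (i <= n)%N & b i != 0) ->
    uniq zs -> uniq ds -> {subset ds <= zs} ->
    (forall x, x \in zs -> 0 < x < 1 /\ homog n alpha b x = 0) ->
    (forall d, d \in ds -> exists k l r, [/\ k != 0, l < d < r
       & forall s, l < s < r -> 0 <= k * homog n alpha b s]) ->
  (size zs + size ds < supp n b)%N.
Proof.
move=> incr b0 uzs uds dszs zs0 ds0.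
have inj : {in zs &, injective (@to_half_line R)}.
  move=> x y /zs0[/andP[_ x1] _] /zs0[/andP[_ y1] _].
  by move=> /(congr1 (@of_half_line R)); rewrite !to_half_lineK.
rewrite -(size_map (@to_half_line R)) -(size_map (@to_half_line R) ds).
apply: (lincomb_zeros incr) => //.
- by rewrite map_inj_in_uniq.
- rewrite map_inj_in_uniq // => x y xd yd; apply: inj; exact: dszs.
- by move=> _ /mapP[x xd ->]; apply: map_f; exact: dszs.
- move=> _ /mapP[x /zs0[/andP[x0 x1] hx] ->]; split.
    by rewrite divr_gt0 // subr_gt0.
  by apply/eqP; rewrite -homog_eq0 ?hx ?eqxx // x1 ltW.
- move=> _ /mapP[d dd ->]; have [d01 hd] := zs0 _ (dszs _ dd).
  have [k [l [r [k0 ldr h]]]] := ds0 _ dd.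
  exact: homog_touch h.
Qed.

Lemma homog_zeros (R : realType) (n : nat) (alpha b : nat -> R) (zs : seq R) :
    (forall i, (i < n)%N -> alpha i < alpha i.+1) ->
    (exists2 i, (i <= n)%N & b i != 0) ->
    uniq zs -> (forall x, x \in zs -> 0 < x < 1 /\ homog n alpha b x = 0) ->
  (size zs < supp n b)%N.
Proof.
move=> incr b0 uzs zs0; rewrite -[size zs]addn0.
exact: (@homog_double_zeros R n alpha b zs [::]).
Qed.
(** * Polynomials with prescribed sign changes *)

(** Prescribing k < n sign changes inside ]0, 1[ leaves room to keep both end
    values nonzero and the coefficient of index 1 equal to 0: the polynomial is
    supported on 0, 2, ..., k, n, and Descartes' bound for these k + 1 terms
    excludes any further zero. *)
Lemma exists_sign_pattern (R : realType) (n : nat) (alpha : nat -> R)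
    (zs : seq R) :
    (1 < n)%N -> (forall i, (i < n)%N -> alpha i < alpha i.+1) ->
    alpha 0%N = 0 -> path <%R 0 zs -> all (< 1) zs -> (size zs < n)%N ->
  exists q : nat -> R, q 1%N = 0 /\
    forall s, 0 <= s <= 1 -> s \notin zs ->
      0 < homog n alpha q s * (-1) ^+ count (< s) zs.
Proof.
move=> n1 incr a0 zs0 zs1 szn.
have a0' : 0 <= alpha 0%N by rewrite a0.
have [zs_nil|zs_neq0] := eqVneq zs [::].
  exists (fun i => ((i == 0) || (i == n))%:R); split.
    by rewrite eq_sym (ltn_eqF n1).
  rewrite zs_nil => s /andP[s0 s1] _ /=; rewrite mulr1.
  move: s1; rewrite le_eqVlt => /orP[/eqP->|s1].
    by rewrite homog1 // eqxx orbT ltr01.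
  rewrite /homog big_ord_recl ltr_wpDr //.
    by apply: sumr_ge0 => i _; rewrite !mulr_ge0 ?powR_ge0.
  by rewrite /= mul1r a0 powRr0 mul1r powR_gt0 // normr_gt0 subr_eq0 gt_eqF.
move: szn; move Ek : (size zs) => k szn.
have k0 : (0 < k)%N by rewrite -Ek lt0n size_eq0.
(* n linear conditions on n + 1 coefficients: the k zeros, and the vanishing of
   the coefficients of index 1 and k + 1, ..., n - 1 *)
pose A : 'M[R]_(n.+1, n) := \matrix_(i, j)
  if (j < k)%N then `|nth 0 zs j| `^ alpha i * `|1 - nth 0 zs j| `^ (alpha n - alpha i)
  else (i == (if j == k :> nat then 1 else j)%N :> nat)%:R.
have : kermx A != 0.
  rewrite kermx_eq0 /row_free neq_ltn; apply/orP; left.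
  by rewrite ltnS rank_leq_col.
move=> /rowV0Pn[v /sub_kermxP vA v0].
pose q (i : nat) : R := v ord0 (inord i).
have qE (i : 'I_n.+1) : q i = v ord0 i by rewrite /q inord_val.
have q0 z : z \in zs -> homog n alpha q z = 0.
  move=> zzs; have jk : (index z zs < k)%N by rewrite -Ek index_mem.
  have jn : (index z zs < n)%N by exact: ltn_trans szn.
  have := congr1 (fun M : 'M[R]_(1, n) => M ord0 (Ordinal jn)) vA.
  rewrite !mxE => <-; apply: eq_bigr => i _.
  by rewrite !mxE /= jk nth_index // qE.
have qj (j : 'I_n) : (k <= j)%N -> q (if j == k :> nat then 1 else j)%N = 0.
  move=> kj; have := congr1 (fun M : 'M[R]_(1, n) => M ord0 j) vA.
  rewrite !mxE => <-; set c := (if _ then _ else _).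
  have cn : (c < n.+1)%N by rewrite /c; case: eqP => _; [lia|rewrite ltnW ?ltnS].
  rewrite (bigD1 (Ordinal cn)) //= mxE ltnNge kj /= -/c eqxx mulr1 -qE /=.
  rewrite big1 ?addr0 // => i ic; rewrite mxE ltnNge kj /= -/c.
  by rewrite (_ : (_ == _) = false) ?mulr0 //; apply: negbTE.
have q1 : q 1%N = 0.
  by have := qj (Ordinal szn) (leqnn _); rewrite /= eqxx.
have qz i : (k < i < n)%N -> q i = 0.
  move=> /andP[ki i_n]; have := qj (Ordinal i_n) (ltnW ki).
  by rewrite /= gtn_eqF.
have q_neq0 : exists2 i, (i <= n)%N & q i != 0.
  have /rV0Pn[i vi] := v0.
  by exists i; rewrite ?qE // leq_ord.
have zs_sorted : sorted <%R zs by exact: path_sorted zs0.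
have uzs : uniq zs by apply: sorted_uniq zs_sorted; [exact: lt_trans|exact: ltxx].
have zs01 z : z \in zs -> 0 < z < 1.
  move=> zzs; apply/andP; split; last exact: (allP zs1 z zzs).
  exact: (allP (order_path_min lt_trans zs0) z zzs).
have zs_zero z : z \in zs -> 0 < z < 1 /\ homog n alpha q z = 0.
  by move=> zz; split; [exact: zs01|exact: q0].
have kq : (k < supp n q)%N.
  by rewrite -Ek; exact: homog_zeros incr q_neq0 uzs zs_zero.
(* neither end coefficient can vanish as well, as k zeros need k + 1 terms *)
have suppq (B : seq nat) : uniq B -> all (fun i => q i == 0) B ->
    all (fun i => (i <= n)%N && ((i == 0) || (i == n))%N) B -> B = [::].
  move=> uB /allP qB /allP Bn.
  have := @supp_le R n q (B ++ 1%N :: iota k.+1 (n - k.+1)).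
  rewrite cat_uniq uB /= iota_uniq andbT size_cat /= size_iota => H.
  suff : (supp n q + (size B + (n - k.+1).+1) <= n.+1)%N.
    move=> HH; apply/eqP; rewrite -size_eq0.
    by move: (supp n q) (size B) HH kq => x y; clear -szn; lia.
  apply: H; last first.
    move=> i; rewrite mem_cat in_cons mem_iota => /or3P[iB|/eqP->|ik].
    - by have /andP[-> _] := Bn _ iB; rewrite (eqP (qB _ iB)).
    - by rewrite ltnW.
    - split; first lia.
      by apply: qz; lia.
  apply/andP; split; last by rewrite mem_iota; lia.
  rewrite negb_or; apply/andP; split.
    by apply/negP => /Bn; lia.
  by apply/hasPn => i; rewrite mem_iota => ik; apply/negP => /Bn; lia.
have q00 : q 0%N != 0.
  by apply/negP => q00; have := suppq [:: 0%N]; rewrite /= q00 => /(_ isT isT isT).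
have qn0 : q n != 0.
  apply/negP => qn0; have := suppq [:: n]; rewrite /= qn0 leqnn eqxx orbT.
  by move=> /(_ isT isT isT).
have supp_k : (supp n q <= k.+1)%N.
  have := @supp_le R n q (1%N :: iota k.+1 (n - k.+1)).
  rewrite /= iota_uniq andbT size_iota => H.
  suff : (supp n q + (n - k.+1).+1 <= n.+1)%N.
    by move: (supp n q) => x; clear -szn; lia.
  apply: H; first by rewrite mem_iota; lia.
  move=> i; rewrite in_cons mem_iota => /orP[/eqP->|ik].
    by rewrite ltnW.
  split; first lia.
  by apply: qz; lia.
have qs s : 0 <= s <= 1 -> s \notin zs -> homog n alpha q s != 0.
  move=> /andP[s0 s1] szs.
  have [->|s00] := eqVneq s 0; first by rewrite homog0.
  have [->|s11] := eqVneq s 1; first by rewrite homog1.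
  apply/negP => /eqP hs.
  have := @homog_zeros R n alpha q (s :: zs) incr q_neq0.
  rewrite /= szs uzs => /(_ isT) H.
  suff : ((size zs).+1 < supp n q)%N by rewrite Ek ltnNge supp_k.
  apply: H => x; rewrite in_cons => /orP[/eqP->|]; last exact: zs_zero.
  by rewrite hs !lt_neqAle eq_sym s00 s0 s11 s1.
have qc := homog_continuous (b := q) incr a0'.
have zs0n : 0 \notin zs by apply/negP => /zs01; rewrite ltxx.
(* normalized to be positive at 0 *)
exists (fun i => homog n alpha q 0 * q i); split; first by rewrite q1 mulr0.
move=> s s01 szs; rewrite homogZ.
apply: (sign_pattern qc ltr01) => // z zz c l r lzr c0 hz.
have := @homog_double_zeros R n alpha q zs [:: z] incr q_neq0 uzs isT.
rewrite Ek addn1 ltnNge supp_k => H; suff : false by [].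
apply: H => //.
- by move=> x; rewrite inE => /eqP->.
- move=> d; rewrite inE => /eqP->; exists c, l, r; split => // x lxr.
  have [->|xz] := eqVneq x z; first by rewrite q0 // mulr0.
  exact/ltW/hz.
Qed.
(** * Separation and perturbation *)

Fixpoint altchain (R : realType) (A B : set R) (a : R) (ss : seq R) : Prop :=
  if ss is s :: ss' then [/\ a < s, A s & altchain B A s ss'] else True.

Lemma first_point (R : realType) (A : set R) (a : R) :
    closed A -> (forall s, A s -> s <= 1) -> (exists2 s, a <= s & A s) ->
  exists c, [/\ a <= c, A c & forall s, a <= s -> A s -> c <= s].
Proof.
move=> cA A1 [s0 as0 As0].
have cpt : compact (`[a, 1] `&` A)%classic.
  by apply: compact_closedI => //; exact: segment_compact.
have [||c] := @compact_EVT_min _ R id _ _ cpt.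
- by exists s0; split => //=; rewrite in_itv /= as0 A1.
- by apply: continuous_subspaceT => x; exact: cvg_id.
- rewrite inE => -[/=]; rewrite in_itv /= => /andP[ac c1] Ac cmin.
  exists c; split => // s as_ As; apply: cmin.
  by rewrite inE; split => //=; rewrite in_itv /= as_ A1.
Qed.

(** A greedy scan from left to right: if A is met after a, take its first point c
    and continue from c with the roles of A and B exchanged.  Since B is closed
    and c is not in B, a separator fits just before c.  Passing an odd number of
    separators then tells A from B. *)
Lemma separators (R : realType) (m : nat) (A B : set R) (a : R) :
    closed A -> closed B -> (forall s, A s -> ~ B s) ->
    (forall s, A s -> s <= 1) -> (forall s, B s -> s <= 1) -> B a ->
  (exists2 ss, size ss = m & altchain A B a ss) \/
  (exists zs, [/\ (size zs < m)%N, path <%R a zs, all (< 1) zs &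
     forall s, a <= s -> A s \/ B s -> s \notin zs /\
       (odd (count (< s) zs) <-> A s)]).
Proof.
elim: m A B a => [|m IH] A B a cA cB AB A1 B1 Ba.
  by left; exists [::].
have [/(first_point cA A1)[c [ac Ac cmin]]|noA] := pselect (exists2 s, a <= s & A s); last first.
  right; exists [::]; split => // s as_ [As|Bs]; split => //=.
    by split => // _; apply: contrapT => _; apply: noA; exists s.
  by split => // As; case: (AB _ As).
have {}ac : a < c.
  rewrite lt_neqAle ac andbT; apply/eqP => e; apply: (AB a) => //.
  by rewrite e.
have BA s : B s -> ~ A s by move=> Bs As; exact: (AB s).
have [[ss sss css]|[zs [szs czs zs1 hzs]]] := IH B A c cB cA BA B1 A1 Ac.
  by left; exists (c :: ss); rewrite /= ?sss.
right.
have [z0 [az0 z0c Bz0]] : exists z0, [/\ a < z0, z0 < c & forall s, z0 <= s -> s <= c -> ~ B s].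
  have : (\forall s \near c, ~ B s).
    by apply: open_nbhs_nbhs; split; [exact: closed_openC|exact: AB].
  move=> /nbhs_ballP[e /= e0 he].
  exists (Num.max ((a + c) / 2) (c - e / 2)); split.
  - by rewrite lt_max; apply/orP; left; lra.
  - by rewrite gt_max; apply/andP; split; lra.
  - move=> s; rewrite ge_max => /andP[_ ces] sc; apply: he.
    by rewrite /ball /= ger0_norm; lra.
have zs_gt u : u \in zs -> c < u := (allP (order_path_min lt_trans czs)) u.
have cnt0 s : s <= c -> count (< s) zs = 0%N.
  move=> sc; apply/eqP; rewrite -leqn0 leqNgt -has_count; apply/hasPn => u /zs_gt.
  by rewrite -leNgt => /ltW; exact: le_trans.
exists (z0 :: zs); split => //=.
- rewrite az0 /=; apply: path_le czs => //; exact: lt_trans.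
- by rewrite zs1 andbT (lt_le_trans z0c) // A1.
- move=> s as_ ABs; have [cs|sc] := leP c s.
    have [] := hzs s cs _; first by case: ABs; [right|left].
    move=> szs' odd_s; rewrite in_cons negb_or szs' andbT gt_eqF ?(lt_le_trans z0c) //.
    rewrite add1n /=; split => //; split.
      by move=> /negP od; case: ABs => // /odd_s.
    by move=> As; apply/negP => /odd_s Bs; exact: (AB s).
  have nAs : ~ A s by move=> As; have := cmin s as_ As; rewrite leNgt sc.
  have Bs : B s by case: ABs.
  have sz0 : s < z0 by rewrite ltNge; apply/negP => z0s; exact: (Bz0 s z0s (ltW sc)).
  rewrite in_cons negb_or (lt_eqF sz0) /= (ltNge z0) (ltW sz0) cnt0 ?(ltW sc) //=.
  split => //; apply/negP => /zs_gt; by rewrite ltNge (ltW sc).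
Qed.

(** Where |P| = F the correction Q has the sign of P, so subtracting a small
    multiple of Q brings |P| below F.  One multiple serves all points, because
    Num.max (F - |P|) (P * Q) has a positive minimum on [0, 1]. *)
Lemma perturb (R : realType) (F P Q : R -> R) :
    continuous F -> continuous P -> continuous Q ->
    (forall s, 0 <= s <= 1 -> 0 < F s) ->
    (forall s, 0 <= s <= 1 -> `|P s| <= F s) ->
    (forall s, 0 <= s <= 1 -> `|P s| = F s -> 0 < P s * Q s) ->
  exists e d, 0 < d < 1 /\
    forall s, 0 <= s <= 1 -> `|P s - e * Q s| <= (1 - d) * F s.
Proof.
move=> cF cP cQ F0 PF PQ.
have cn (f : R -> R) : continuous f -> continuous (fun s => `|f s|).
  move=> cf s; apply: (@continuous_comp _ _ _ f (fun x : R => `|x|)); first exact: cf.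
  exact: norm_continuous.
have itv01 (s : R) : (s \in `[0, 1]%R) = (0 <= s <= 1) by rewrite in_itv.
have cpsi : continuous (fun s => Num.max (F s - `|P s|) (P s * Q s)).
  move=> s; apply: (@continuous_max _ _ (fun s => F s - `|P s|) (fun s => P s * Q s)).
    by apply: (@continuousB _ _ _ F (fun s => `|P s|)); [exact: cF|exact: cn].
  by apply: (@continuousM _ _ P Q); [exact: cP|exact: cQ].
have [c c01 cmin] := EVT_min ler01 (continuous_within (a := 0) (b := 1) cpsi).
have [x x01 xmax] := EVT_max ler01 (continuous_within (a := 0) (b := 1) (cn _ cQ)).
have [y y01 ymax] := EVT_max ler01 (continuous_within (a := 0) (b := 1) cF).
move: cmin; set m := Num.max _ _ => cmin.
have m0 : 0 < m.
  rewrite /m lt_max; rewrite itv01 in c01.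
  have [eqPF|neqPF] := eqVneq `|P c| (F c).
    by rewrite PQ // orbT.
  by rewrite subr_gt0 lt_neqAle neqPF PF.
set M := `|Q x| in xmax; have M0 : 0 <= M by exact: normr_ge0.
(* small enough for both e * M < m and e * M ^ 2 < m *)
pose e := m / (M + 1) ^+ 2.
have M1 : 0 < (M + 1) ^+ 2 by apply: exprn_gt0; lra.
have e0 : 0 < e by rewrite divr_gt0.
have eM : e * M < m.
  by rewrite /e mulrAC ltr_pdivrMr //; nra.
have eMM : e * M ^+ 2 < m.
  by rewrite /e mulrAC ltr_pdivrMr //; nra.
have strict s : 0 <= s <= 1 -> `|P s - e * Q s| < F s.
  move=> s01; have := cmin s; rewrite itv01 => /(_ s01).
  have QM := xmax s; rewrite itv01 in QM; have {}QM := QM s01.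
  rewrite le_max => /orP[h|h].
    apply: le_lt_trans (ler_normB _ _) _; rewrite normrM (gtr0_norm e0).
    have : e * `|Q s| <= e * M by rewrite ler_pM2l.
    by lra.
  have Fs := F0 s s01.
  rewrite -(@ltr_pXn2r _ 2) ?nnegrE ?(ltW Fs) // real_normK ?num_real //.
  have PF2 : P s ^+ 2 <= F s ^+ 2.
    by rewrite -[P s ^+ 2]real_normK ?num_real // ler_pXn2r ?nnegrE ?(ltW Fs) ?PF.
  have QM2 : Q s ^+ 2 <= M ^+ 2.
    by rewrite -[Q s ^+ 2]real_normK ?num_real // ler_pXn2r ?nnegrE.
  have h1 : e * m <= e * (P s * Q s) by rewrite ler_pM2l.
  have h2 : e * (e * Q s ^+ 2) <= e * (e * M ^+ 2) by rewrite !ler_pM2l.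
  have h3 : e * (e * M ^+ 2) < e * m by rewrite ltr_pM2l.
  have -> : (P s - e * Q s) ^+ 2
    = P s ^+ 2 - 2 * (e * (P s * Q s)) + e * (e * Q s ^+ 2) by ring.
  have : 0 < e * m by rewrite mulr_gt0.
  by lra.
have cr : continuous (fun s => F s - `|P s - e * Q s|).
  move=> s; apply: (@continuousB _ _ _ F (fun s => `|P s - e * Q s|)); first exact: cF.
  apply: cn => {}s; apply: (@continuousB _ _ _ P (fun s => e * Q s)); first exact: cP.
  by apply: (@continuousM _ _ (cst e) Q); [exact: cst_continuous|exact: cQ].
have [w w01 wmin] := EVT_min ler01 (continuous_within (a := 0) (b := 1) cr).
pose r := F w - `|P w - e * Q w|.
have r0 : 0 < r by rewrite subr_gt0 strict // -itv01.
have Fy : 0 < F y by rewrite F0 // -itv01.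
exists e, (r / (r + F y)); split.
  by rewrite divr_gt0 ?ltr_pdivrMr /=; lra.
move=> s s01.
have rs : r <= F s - `|P s - e * Q s| by apply: wmin; rewrite itv01.
have Fsy := ymax s; rewrite itv01 in Fsy; have {}Fsy := Fsy s01.
have : r / (r + F y) * F s <= r.
  by rewrite mulrAC ler_pdivrMr; nra.
by lra.
Qed.
(** * The extremal problem *)

Definition feasible (R : realType) (n : nat) (alpha a b : nat -> R) : Prop :=
  forall s, 0 <= s <= 1 -> `|homog n alpha b s| <= homog n alpha a s.

(** The overall sign is left open, and the end points 0 and 1 are not prescribed:
    they occur automatically. *)
Definition touching (R : realType) (n : nat) (alpha a b : nat -> R)
    (ss : seq R) : Prop :=
  [/\ size ss = n.+1,
      sorted (fun u v => (u < v) && (homog n alpha b u * homog n alpha b v < 0)) ss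
    & forall s, s \in ss ->
        0 <= s <= 1 /\ `|homog n alpha b s| = homog n alpha a s].

Lemma homog_neq0 (R : realType) (n : nat) (alpha b : nat -> R) (s : R) :
  homog n alpha b s != 0 -> exists2 i, (i <= n)%N & b i != 0.
Proof.
move=> h; apply: contrapT => nb; move/eqP: h; apply.
rewrite /homog big1 // => i _; have [->|bi] := eqVneq (b i) 0; first by rewrite mul0r.
by case: nb; exists i => //; exact: leq_ord.
Qed.

Lemma homog_gt0 (R : realType) (n : nat) (alpha a : nat -> R) :
    (forall i, (i < n)%N -> alpha i < alpha i.+1) ->
    (forall t, 0 <= t -> 0 < lincomb n alpha a t) -> 0 < a n ->
  forall s, 0 <= s <= 1 -> 0 < homog n alpha a s.
Proof.
move=> incr f0 an s /andP[s0]; rewrite le_eqVlt => /orP[/eqP->|s1].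
  by rewrite homog1.
rewrite homogE ?s0 // mulr_gt0 ?powR_gt0 ?subr_gt0 // f0 // divr_ge0 //.
by rewrite subr_ge0 ltW.
Qed.

(** The factor k covers chains starting at F and at - F alike; it changes sign
    along the induction. *)
Lemma altchain_touching (R : realType) (P F : R -> R) (k : R) (A B : set R)
    (c : R) (ss : seq R) :
    k != 0 ->
    (forall s, A s -> 0 <= s <= 1 /\ k * P s = - F s) ->
    (forall s, B s -> 0 <= s <= 1 /\ k * P s = F s) ->
    (forall s, 0 <= s <= 1 -> 0 < F s) ->
    B c -> altchain A B c ss ->
  path (fun u v => (u < v) && (P u * P v < 0)) c ss
  /\ (forall s, s \in ss -> A s \/ B s).
Proof.
move=> k0 hA hB hF.
elim: ss A B k c k0 hA hB => [|s ss IH] A B k c k0 hA hB //= Bc [cs As chain].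
have [s01 kPs] := hA s As; have [c01 kPc] := hB c Bc.
have k0' : - k != 0 by rewrite oppr_eq0.
have hA' u : B u -> 0 <= u <= 1 /\ - k * P u = - F u.
  by move=> /hB[? kP]; split=> //; rewrite mulNr kP.
have hB' u : A u -> 0 <= u <= 1 /\ - k * P u = F u.
  by move=> /hA[? kP]; split=> //; rewrite mulNr kP opprK.
have [pss hss] := IH B A (- k) s k0' hA' hB' As chain.
split.
  rewrite cs pss andbT /=.
  have : 0 < F s * F c by rewrite mulr_gt0 ?hF.
  have -> : F s * F c = - (k ^+ 2 * (P c * P s)).
    by rewrite -kPc -[F s]opprK -kPs; ring.
  by rewrite oppr_gt0 pmulr_rlt0 // exprn_even_gt0.
by move=> u; rewrite in_cons => /orP[/eqP->|/hss[]]; [left|right|left].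
Qed.

Lemma closed_level (R : realType) (f g : R -> R) :
  continuous f -> continuous g ->
  closed [set s : R | 0 <= s <= 1 /\ f s = g s]%classic.
Proof.
move=> cf cg.
have -> : [set s : R | 0 <= s <= 1 /\ f s = g s]%classic
    = (`[0, 1] `&` (fun s : R => (f s - g s)%R) @^-1` [set 0%R])%classic.
  apply/seteqP; split => s /=; rewrite in_itv /=.
    by move=> [-> ->]; rewrite subrr.
  by move=> [-> /eqP]; rewrite subr_eq0 => /eqP.
apply: closedI; first exact: itv_closed.
apply: preimage_closed; last exact: closed_eq.
by move=> s _; apply: (@continuousB _ _ _ f g); [exact: cf|exact: cg].
Qed.

(** Fewer than n + 1 alternations would leave room for a correction with the
    same coefficient of index 1 that makes the constraint slack everywhere;
    scaling up then increases that coefficient. *)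
Lemma maximizer_touching (R : realType) (n : nat) (alpha a b : nat -> R) :
    (1 < n)%N -> (forall i, (i < n)%N -> alpha i < alpha i.+1) ->
    alpha 0%N = 0 -> (forall s, 0 <= s <= 1 -> 0 < homog n alpha a s) ->
    feasible n alpha a b -> 0 < b 1%N ->
    (forall c, feasible n alpha a c -> c 1%N <= b 1%N) ->
  exists ss, touching n alpha a b ss.
Proof.
move=> n1 incr a0 hF fb b1 bmax.
have a0' : 0 <= alpha 0%N by rewrite a0.
have cF := homog_continuous (b := a) incr a0'.
have cP := homog_continuous (b := b) incr a0'.
(* no correction with vanishing coefficient of index 1 can lower every contact *)
have improve (q : nat -> R) : q 1%N = 0 ->
    ~ (forall s, 0 <= s <= 1 -> `|homog n alpha b s| = homog n alpha a s ->
       0 < homog n alpha b s * homog n alpha q s).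
  move=> q1 hq; have cQ := homog_continuous (b := q) incr a0'.
  have [e [d [/andP[d0 d1] hd]]] := perturb cF cP cQ hF fb hq.
  have : feasible n alpha a (fun i => (1 - d)^-1 * b i + (- e / (1 - d)) * q i).
    move=> s s01; rewrite homog_lin.
    have -> : (1 - d)^-1 * homog n alpha b s + - e / (1 - d) * homog n alpha q s
       = (1 - d)^-1 * (homog n alpha b s - e * homog n alpha q s) by field; lra.
    rewrite normrM gtr0_norm; last by rewrite invr_gt0; lra.
    by rewrite mulrC ler_pdivrMr; [rewrite [leRHS]mulrC hd|lra].
  move=> /bmax; rewrite q1 mulr0 addr0 leNgt; apply/negP/negPn.
  by rewrite mulrC ltr_pdivlMr; nra.
have cT : closed [set s : R | 0 <= s <= 1 /\ `|homog n alpha b s| = homog n alpha a s]%classic.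
  apply: closed_level => // s.
  apply: (@continuous_comp _ _ _ (homog n alpha b) (fun x : R => `|x|)); first exact: cP.
  exact: norm_continuous.
have [T0|noT] := pselect (exists2 s, 0 <= s & 0 <= s <= 1 /\
    `|homog n alpha b s| = homog n alpha a s); last first.
  (* nothing is touched, so the correction 0 already improves *)
  case: (improve (fun=> 0)) => // s s01 hs; case: noT; exists s => //.
  by case/andP: s01.
have [c [c0 [c01 hc] cmin]] := first_point cT (fun s hs => proj2 (andP (proj1 hs))) T0.
(* k is the sign of the contact at the first touching point c *)
have [k [kn hkc]] : exists k : R, `|k| = 1 /\ k * homog n alpha b c = homog n alpha a c.
  have [hb|hb] := leP 0 (homog n alpha b c).
    by exists 1; rewrite normr1 mul1r -hc ger0_norm.
  by exists (- 1); rewrite normrN normr1 mulN1r -hc ltr0_norm.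
have k0 : k != 0 by rewrite -normr_gt0 kn.
have kk := norm1_sqr kn.
have ckP : continuous (fun s => k * homog n alpha b s).
  move=> s; apply: (@continuousM _ _ (cst k) (homog n alpha b)); last exact: cP.
  exact: cst_continuous.
pose A := [set s : R | 0 <= s <= 1 /\ k * homog n alpha b s = - homog n alpha a s]%classic.
pose B := [set s : R | 0 <= s <= 1 /\ k * homog n alpha b s = homog n alpha a s]%classic.
have cA : closed A.
  by apply: closed_level => // s; apply: (@continuousN _ _ _ (homog n alpha a)); exact: cF.
have cB : closed B by exact: closed_level.
have AB s : A s -> ~ B s.
  by move=> [s01 e1] [_ e2]; have := hF s s01; lra.
have A1 s : A s -> s <= 1 by move=> [/andP[]].
have B1 s : B s -> s <= 1 by move=> [/andP[]].
have Bc : B c by [].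
have touch s : 0 <= s <= 1 -> `|homog n alpha b s| = homog n alpha a s -> A s \/ B s.
  move=> s01 hs; have : `|k * homog n alpha b s| = homog n alpha a s.
    by rewrite normrM kn mul1r.
  case: (ger0P (k * homog n alpha b s)) => _ e; [right|left]; split => //.
  by rewrite -e opprK.
have touch' s : A s \/ B s -> 0 <= s <= 1 /\ `|homog n alpha b s| = homog n alpha a s.
  move=> h; have [s01 hs] : 0 <= s <= 1 /\ `|k * homog n alpha b s| = homog n alpha a s.
    case: h => [[s01 e]|[s01 e]]; split => //; rewrite e ?normrN gtr0_norm //; exact: hF.
  by split => //; rewrite -hs normrM kn mul1r.
have [[ss sss chain]|[zs [szs czs zs1 hzs]]] :=
    separators n cA cB AB A1 B1 Bc.
  exists (c :: ss).
  have [pss hss] := altchain_touching k0 (fun s h => h) (fun s h => h) hF Bc chain.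
  split => //=; first by rewrite sss.
  by move=> s; rewrite in_cons => /orP[/eqP->|/hss/touch'].
have zs0 : path <%R 0 zs.
  by case: (zs) czs => //= z zs' /andP[cz ->]; rewrite (le_lt_trans c0 cz).
have [q [q1 hq]] := exists_sign_pattern n1 incr a0 zs0 zs1 szs.
case: (improve (fun i => k * q i)) => [|s s01 hs]; first by rewrite q1 mulr0.
rewrite homogZ.
have cs : c <= s by apply: cmin => //; case/andP: s01.
have [szs' odd_s] := hzs s cs (touch s s01 hs).
have := hq s s01 szs'; rewrite -signr_odd.
have Fs := hF s s01.
rewrite [X in _ -> is_true (_ < X)]mulrCA [X in _ -> is_true (_ < X)]mulrA.
case: (touch s s01 hs) => [As|Bs].
  have -> : odd (count (< s) zs) by apply/odd_s.
  by rewrite expr1 (proj2 As) mulrN1 oppr_gt0 => hqs; nra.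
have -> : odd (count (< s) zs) = false.
  by apply/negP => /odd_s As; exact: (AB s).
by rewrite expr0 mulr1 (proj2 Bs) => hqs; rewrite mulr_gt0.
Qed.
(** If c had the larger coefficient, some k * c with |k| < 1 would share the
    coefficient of b.  Then b - k * c keeps the n + 1 alternating signs of b and
    so has n zeros, but at most n terms. *)
Lemma touching_extremal (R : realType) (n : nat) (alpha a b c : nat -> R)
    (ss : seq R) :
    (0 < n)%N -> (forall i, (i < n)%N -> alpha i < alpha i.+1) ->
    alpha 0%N = 0 -> (forall s, 0 <= s <= 1 -> 0 < homog n alpha a s) ->
    touching n alpha a b ss -> feasible n alpha a c ->
  `|c 1%N| <= `|b 1%N|.
Proof.
move=> n0 incr a0 hF [sss srt hss] fc; rewrite leNgt; apply/negP => bc.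
have c1 : c 1%N != 0 by rewrite -normr_gt0 (le_lt_trans _ bc).
pose k := b 1%N / c 1%N.
have k1 : `|k| < 1 by rewrite normrM normfV ltr_pdivrMr ?mul1r ?normr_gt0.
pose d i := b i - k * c i.
have d1 : d 1%N = 0 by rewrite /d /k; field.
have dE s : homog n alpha d s = homog n alpha b s - k * homog n alpha c s.
  by rewrite /d homogB homogZ.
have small s : s \in ss -> `|k * homog n alpha c s| < `|homog n alpha b s|.
  move=> /hss[s01 ->]; rewrite normrM.
  have := hF s s01; have := fc s s01; have := normr_ge0 k.
  by nra.
have same_sgn s : s \in ss -> 0 < homog n alpha d s * homog n alpha b s.
  move=> /small; rewrite dE => h.
  have : `|k * homog n alpha c s * homog n alpha b s| < homog n alpha b s ^+ 2.
    rewrite normrM -[X in _ < X]real_normK ?num_real // expr2 ltr_pM2r //.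
    exact: le_lt_trans h.
  by rewrite ltr_norml => /andP[_]; lra.
case: ss sss srt hss small same_sgn => [//|x ss] /= [sss] srt hss small same_sgn.
have srt' : path (fun u v => (u < v) && (homog n alpha d u * homog n alpha d v < 0)) x ss.
  apply: (@sub_in_path _ [pred u | u \in x :: ss] _ _ _ _ _ _ srt); last first.
    by apply/allP.
  move=> u v /same_sgn du /same_sgn dv /andP[-> buv] /=.
  have : 0 < (homog n alpha d u * homog n alpha b u)
           * (homog n alpha d v * homog n alpha b v) by rewrite mulr_gt0.
  rewrite mulrACA [in X in X -> _]mulrC => h.
  by rewrite -(nmulr_rgt0 _ buv).
have cd := homog_continuous (b := d) incr (eq_ind_r (fun z => 0 <= z) (lexx 0) a0).
have [zs [szs uzs hzs]] := alternating_zeros cd srt'.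
have xss : x \in x :: ss by rewrite mem_head.
have [/andP[x0 _] _] := hss x xss.
have [/andP[_ l1] _] := hss _ (mem_last x ss).
have dne : exists2 i, (i <= n)%N & d i != 0.
  apply: (@homog_neq0 R n alpha d x).
  by apply/eqP => e; have := same_sgn x xss; rewrite e mul0r ltxx.
have : (size zs < supp n d)%N.
  apply: (homog_zeros incr dne uzs) => z /hzs[xz zl dz]; split => //.
  by rewrite (le_lt_trans x0 xz) (lt_le_trans zl l1).
have := @supp_le R n d [:: 1%N] isT.
rewrite szs sss /= addn1 ltnS => H; rewrite ltnNge H // => i.
by rewrite inE => /eqP->.
Qed.

Definition interior (R : realType) (zs : seq R) : seq R :=
  [seq z <- zs | (z != 0) && (z != 1)].

(** A zero at an end point of [0, 1] is the vanishing of an extreme coefficient,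
    hence lowers the number of terms. *)
Lemma interior_zeros (R : realType) (n : nat) (alpha g : nat -> R) (zs : seq R) :
    (0 < n)%N -> (forall i, (i < n)%N -> alpha i < alpha i.+1) ->
    alpha 0%N = 0 -> uniq zs ->
    (forall z, z \in zs -> 0 <= z <= 1 /\ homog n alpha g z = 0) ->
  let e := ((0%R \in zs) + (1%R \in zs))%N in
  [/\ size zs = (size (interior zs) + e)%N, (supp n g + e <= n.+1)%N,
      uniq (interior zs) &
      forall z, z \in interior zs -> 0 < z < 1 /\ homog n alpha g z = 0].
Proof.
move=> n0 incr a0 uzs hzs e; split.
- rewrite /e -!(count_uniq_mem _ uzs) /interior; elim: (zs) => //= z l {1}->.
  have [->|z0] := eqVneq z 0; first by rewrite eq_sym oner_eq0 /=; lia.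
  by have [_|_] := eqVneq z 1; rewrite /=; lia.
- pose ends := [seq i <- [:: 0; n]%N
    | (i == 0)%N && (0%R \in zs) || (i == n)%N && (1%R \in zs)].
  have := @supp_le R n g ends.
  have -> : size ends = e.
    rewrite /ends /e /= !eqxx /= [(0 == n)%N]eq_sym gtn_eqF //= orbF.
    by case: (0 \in zs); case: (1 \in zs).
  apply; first by rewrite filter_uniq //= inE ltn_eqF.
  move=> i; rewrite mem_filter !inE => /andP[/orP[]/andP[/eqP-> zz] _]; split => //.
    by rewrite -(homog0 g incr a0); have [] := hzs _ zz.
  by rewrite -(homog1 g incr); have [] := hzs _ zz.
- exact: filter_uniq.
- move=> z; rewrite mem_filter => /andP[/andP[z0 z1] zz].
  have [/andP[z0' z1'] gz] := hzs z zz.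
  by split => //; rewrite !lt_neqAle eq_sym z0 z0' z1 z1'.
Qed.

Lemma closed_zeros (R : realType) (n : nat) (alpha g : nat -> R) (zs : seq R) :
    (0 < n)%N -> (forall i, (i < n)%N -> alpha i < alpha i.+1) ->
    alpha 0%N = 0 -> (exists2 i, (i <= n)%N & g i != 0) -> uniq zs ->
    (forall z, z \in zs -> 0 <= z <= 1 /\ homog n alpha g z = 0) ->
  (size zs <= n)%N.
Proof.
move=> n0 incr a0 gne uzs hzs.
have [-> sg ui hi] := interior_zeros n0 incr a0 uzs hzs.
by have := homog_zeros incr gne ui hi; move: (supp n g) sg => x; lia.
Qed.

(** Zeros inside ]0, 1[ are minima, hence count twice in Descartes' bound, while
    a zero at an end point only costs one term. *)
Lemma nonneg_zeros (R : realType) (n : nat) (alpha g : nat -> R) (zs : seq R) :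
    (0 < n)%N -> (forall i, (i < n)%N -> alpha i < alpha i.+1) ->
    alpha 0%N = 0 -> (exists2 i, (i <= n)%N & g i != 0) ->
    (forall s, 0 <= s <= 1 -> 0 <= homog n alpha g s) ->
    uniq zs -> (forall z, z \in zs -> 0 <= z <= 1 /\ homog n alpha g z = 0) ->
  ((size zs).*2 <= n + ((0%R \in zs) + (1%R \in zs)))%N.
Proof.
move=> n0 incr a0 gne g0 uzs hzs.
have [-> sg ui hi] := interior_zeros n0 incr a0 uzs hzs.
suff : (size (interior zs) + size (interior zs) < supp n g)%N.
  by move: (supp n g) sg => x; lia.
apply: (homog_double_zeros incr gne ui ui) => //.
move=> z /hi[/andP[z0 z1] _]; exists 1, 0, 1; rewrite oner_eq0 z0 z1.
by split => // s /andP[s0 s1]; rewrite mul1r g0 // !ltW.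
Qed.
(** The n + 1 touching points are the zeros of a - b and of a + b.  The bound for
    nonnegative polynomials, added up for these two, reads
    2 (n + 1) <= 2 n + e with e the number of end points that occur. *)
Lemma touching_ends (R : realType) (n : nat) (alpha a b : nat -> R)
    (ss : seq R) :
    (0 < n)%N -> (forall i, (i < n)%N -> alpha i < alpha i.+1) ->
    alpha 0%N = 0 -> (forall s, 0 <= s <= 1 -> 0 < homog n alpha a s) ->
    feasible n alpha a b -> touching n alpha a b ss ->
  0 \in ss /\ 1 \in ss.
Proof.
move=> n0 incr a0 hF fb [sss srt hss].
have uss : uniq ss.
  have : sorted <%R ss.
    by case: (ss) srt => //= x l; apply: sub_path => u v /andP[].
  by apply: sorted_uniq; [exact: lt_trans|exact: ltxx].
(* both a + b and a - b are nonnegative and not the zero polynomial *)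
have gE k s : homog n alpha (fun i => 1 * a i + k * b i) s
    = homog n alpha a s + k * homog n alpha b s by rewrite homog_lin mul1r.
have [u [v [uss' vss' uv]]] : exists u v, [/\ u \in ss, v \in ss
    & homog n alpha b u * homog n alpha b v < 0].
  case: (ss) sss srt => [//|x [|y l]] /=; first by move=> [n00]; rewrite -n00 in n0.
  by move=> _ /andP[/andP[_ h] _]; exists x, y; rewrite !inE !eqxx orbT.
have gne k : `|k| = 1 -> exists2 i, (i <= n)%N & 1 * a i + k * b i != 0.
  move=> k1; have [hu|hu] := leP 0 (k * homog n alpha b u).
    apply: (@homog_neq0 R n alpha (fun i => 1 * a i + k * b i) u).
    have [u01 _] := hss u uss'; have := hF u u01.
    by rewrite gE; lra.
  apply: (@homog_neq0 R n alpha (fun i => 1 * a i + k * b i) v).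
  have [v01 _] := hss v vss'; have := hF v v01.
  have kk := norm1_sqr k1.
  have : 0 < k * homog n alpha b v.
    rewrite -(nmulr_rlt0 _ hu).
    have -> : k * homog n alpha b u * (k * homog n alpha b v)
        = (k * k) * (homog n alpha b u * homog n alpha b v) by ring.
    by rewrite kk mul1r.
  by rewrite gE; lra.
have g0 k : `|k| = 1 -> forall s, 0 <= s <= 1 ->
    0 <= homog n alpha (fun i => 1 * a i + k * b i) s.
  move=> k1 s s01; rewrite gE; have := fb s s01.
  have : `|k * homog n alpha b s| = `|homog n alpha b s| by rewrite normrM k1 mul1r.
  by move=> <-; rewrite ler_norml => /andP[]; lra.
pose Z k := [seq s <- ss | homog n alpha b s == k * homog n alpha a s].
have ZP k : `|k| = 1 ->
    ((size (Z k)).*2 <= n + ((0%R \in Z k) + (1%R \in Z k)))%N.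
  move=> k1; have k1' : `|- k| = 1 by rewrite normrN.
  have kk := norm1_sqr k1.
  apply: (nonneg_zeros n0 incr a0 (gne _ k1') (g0 _ k1')).
    exact: filter_uniq.
  move=> s; rewrite mem_filter => /andP[/eqP e /hss[s01 _]]; split => //.
  by rewrite gE e mulNr mulrA kk mul1r subrr.
have disj s : s \in ss -> (s \in Z (-1)) = (s \notin Z 1).
  move=> sss'; rewrite !mem_filter sss' !andbT mulN1r mul1r.
  have [s01 hs] := hss s sss'; have Fs := hF s s01.
  move: hs; case: (ger0P (homog n alpha b s)) => _ e.
    by rewrite e eqxx /=; apply/negbTE/eqP => e'; lra.
  have -> : homog n alpha b s = - homog n alpha a s by rewrite -e opprK.
  by rewrite eqxx; apply/esym/negP => /eqP e'; lra.
have szZ : (size (Z 1%R) + size (Z (-1)%R))%N = n.+1.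
  rewrite -sss -(count_predC (fun s => homog n alpha b s == 1 * homog n alpha a s) ss).
  rewrite !size_filter; congr (_ + _)%N; apply: eq_in_count => s sss'.
  by have := disj s sss'; rewrite !mem_filter sss' !andbT.
have sub k s : s \in Z k -> s \in ss by rewrite mem_filter => /andP[].
have le1 s : ((s \in Z 1%R) + (s \in Z (-1)%R) <= (s \in ss))%N.
  have [sss'|nss] := boolP (s \in ss); first by rewrite disj //; case: (s \in Z 1).
  by rewrite !mem_filter (negPf nss) !andbF.
have := ZP 1 (normr1 _); have := ZP (-1) _; rewrite normrN normr1 => /(_ erefl).
have := le1 0; have := le1 1; move: szZ.
move: (size (Z 1)) (size (Z (-1))) => p q.
move: (nat_of_bool (0 \in Z 1)) (nat_of_bool (1 \in Z 1)) => z1 o1.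
move: (nat_of_bool (0 \in Z (-1))) (nat_of_bool (1 \in Z (-1))) => z2 o2.
clear; case: (0 \in ss); case: (1 \in ss) => /= *; split => //; lia.
Qed.
(** The feasible set is compact: a polynomial is determined, linearly, by its
    values at n + 1 nodes, and these values are bounded by those of a. *)
Lemma exists_maximizer (R : realType) (n : nat) (alpha a : nat -> R) :
    (0 < n)%N -> (forall i, (i < n)%N -> alpha i < alpha i.+1) ->
    alpha 0%N = 0 -> (forall s, 0 <= s <= 1 -> 0 < homog n alpha a s) ->
  exists b, feasible n alpha a b /\ forall c, feasible n alpha a c -> c 1%N <= b 1%N.
Proof.
move=> n0 incr a0 hF.
pose U (i : nat) (s : R) := `|s| `^ alpha i * `|1 - s| `^ (alpha n - alpha i).
(* any n + 1 distinct points inside ]0, 1[ would do *)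
pose node (j : nat) : R := j.+1%:R / n.+2%:R.
have node01 (j : 'I_n.+1) : 0 < node j < 1.
  by rewrite divr_gt0 //= ltr_pdivrMr // mul1r ltr_nat ltnS ltn_ord.
pose V : 'M[R]_n.+1 := \matrix_(i, j) U i (node j).
have unitV : V \in unitmx.
  rewrite -row_free_unit -kermx_eq0; apply/negPn/negP.
  move=> /rowV0Pn[v /sub_kermxP vV v0].
  pose q (i : nat) : R := v ord0 (inord i).
  have qne : exists2 i, (i <= n)%N & q i != 0.
    by have /rV0Pn[i vi] := v0; exists i; rewrite ?leq_ord // /q inord_val.
  have := @homog_zeros R n alpha q [seq node (val j) | j <- enum 'I_n.+1] incr qne.
  rewrite size_map size_enum_ord => H.
  suff : (n.+1 < supp n q)%N.
    rewrite ltnNge; move=> /negP; apply.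
    by rewrite /supp -[X in (_ <= X)%N](card_ord n.+1) max_card.
  apply: H.
    rewrite map_inj_uniq ?enum_uniq // => i j /= /mulIf eij; apply/val_inj.
    have /eqP := eij (invr_neq0 (lt0r_neq0 (ltr0Sn R n.+1))).
    by rewrite eqr_nat eqSS => /eqP.
  move=> x /mapP[j _ ->]; split; first exact: node01.
  have := congr1 (fun M : 'M[R]_(1, n.+1) => M ord0 j) vV.
  rewrite !mxE => <-; apply: eq_bigr => i _.
  by rewrite !mxE /q inord_val.
pose co (v : 'rV[R]_n.+1) (i : nat) : R := (v *m invmx V) ord0 (inord i).
have coE v s : homog n alpha (co v) s
    = \sum_(i < n.+1) (\sum_(j < n.+1) v ord0 j * invmx V j i) * U i s.
  by apply: eq_bigr => i _; rewrite /co inord_val mxE.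
have co_node v (j : 'I_n.+1) : homog n alpha (co v) (node j) = v ord0 j.
  rewrite -[v in RHS](mulmxKV unitV) [RHS]mxE; apply: eq_bigr => i _.
  by rewrite /co inord_val [V i j]mxE.
have co_surj c : exists v, forall i, (i <= n)%N -> co v i = c i.
  exists ((\row_j c (val j)) *m V) => i i_n.
  by rewrite /co mulmxK // mxE /= inordK.
have ccoef i : continuous (fun v : 'rV[R]_n.+1 => \sum_(j < n.+1) v ord0 j * invmx V j i).
  apply: continuous_bigsum => j v.
  apply: (@continuousM _ _ (fun v : 'rV[R]_n.+1 => v ord0 j) (cst (invmx V j i))).
    exact: coord_continuous.
  exact: cst_continuous.
have cval s : continuous (fun v : 'rV[R]_n.+1 => homog n alpha (co v) s).
  have -> : (fun v : 'rV[R]_n.+1 => homog n alpha (co v) s) = fun v =>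
     \sum_(i < n.+1) (\sum_(j < n.+1) v ord0 j * invmx V j i) * U i s.
    by apply/funext => v; exact: coE.
  apply: continuous_bigsum => i v.
  apply: (@continuousM _ _ (fun v : 'rV[R]_n.+1 => \sum_(j < n.+1) v ord0 j * invmx V j i)
    (cst (U i s))); [exact: ccoef|exact: cst_continuous].
pose K := [set v : 'rV[R]_n.+1 | feasible n alpha a (co v)]%classic.
have cK : closed K.
  have -> : K = (\bigcap_(s in `[0%R, 1%R]) (fun v : 'rV[R]_n.+1 => homog n alpha (co v) s) @^-1`
       `[(- homog n alpha a s)%R, homog n alpha a s])%classic.
    apply/seteqP; split => v /=.
      by move=> fv s /=; rewrite !in_itv /= -ler_norml => /fv.
    by move=> fv s s01; have := fv s; rewrite /= !in_itv /= -ler_norml; apply.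
  apply: closed_bigI => s _; apply: preimage_closed; last exact: itv_closed.
  by move=> v _; exact: cval.
have cptK : compact K.
  pose I (j : 'I_n.+1) : set R :=
    `[- homog n alpha a (node j), homog n alpha a (node j)]%classic.
  have cbox : compact [set v : 'rV[R]_n.+1 | forall j, I j (v ord0 j)]%classic.
    by apply: rV_compact => j; exact: segment_compact.
  apply: subclosed_compact cK cbox _.
  move=> v fv j; rewrite /I /= in_itv /= -ler_norml -co_node; apply: fv.
  by have /andP[/ltW -> /ltW ->] := node01 j.
(* co v is the polynomial with the values v at the nodes *)
have [||v] := @compact_EVT_max _ R (fun v => co v 1%N) K _ cptK.
- exists 0 => s s01; rewrite /homog big1 ?normr0; first exact/ltW/hF.
  by move=> i _; rewrite /co mul0mx mxE mul0r.
- apply: continuous_subspaceT.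
  have -> : (fun v => co v 1%N) = fun v : 'rV[R]_n.+1 =>
      \sum_(j < n.+1) v ord0 j * invmx V j (inord 1).
    by apply/funext => v; rewrite /co mxE.
  exact: ccoef.
rewrite inE => fv vmax; exists (co v); split => // c fc.
have [w wc] := co_surj c; rewrite -(wc 1%N n0); apply: vmax.
rewrite inE /K /= => s s01; have -> : homog n alpha (co w) s = homog n alpha c s.
  by apply: eq_bigr => i _; rewrite wc // leq_ord.
exact: fc.
Qed.
(** * The alternating polynomial *)

(** The sign is + at t n = 1, that is at oo, because f_* - f^* has the leading
    coefficient of f. *)
Definition alternates (R : realType) (n : nat) (alpha a b : nat -> R) (t : nat -> R)
    : Prop :=
  [/\ feasible n alpha a b, t 0%N = 0, t n = 1,
      (forall i, (i < n)%N -> t i < t i.+1)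
    & forall i, (i <= n)%N ->
        homog n alpha b (t i) = (-1) ^+ (n + i) * homog n alpha a (t i)].

Lemma alternates_touching (R : realType) (n : nat) (alpha a b t : nat -> R) :
    (forall i, (i < n)%N -> alpha i < alpha i.+1) -> alpha 0%N = 0 ->
    (forall s, 0 <= s <= 1 -> 0 < homog n alpha a s) ->
    alternates n alpha a b t ->
  touching n alpha a b (mkseq t n.+1).
Proof.
move=> incr a0 hF [fb t0 tn ti tb].
have t01 i : (i <= n)%N -> 0 <= t i <= 1.
  by move=> i_n; rewrite -{1}t0 -tn !(incr_le ti).
split; first by rewrite size_mkseq.
- apply/(sortedP 0) => i; rewrite size_mkseq ltnS => i_n.
  rewrite !nth_mkseq //; last by rewrite ltnS ltnW.
  rewrite ti //= (tb _ i_n) (tb _ (ltnW i_n)) addnS exprS.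
  have F0 := hF _ (t01 i (ltnW i_n)); have F1 := hF _ (t01 i.+1 i_n).
  set x := homog n alpha a (t i) in F0 *.
  set y := homog n alpha a (t i.+1) in F1 *.
  have -> : (-1) ^+ (n + i) * x * (-1 * (-1) ^+ (n + i) * y)
    = - (((-1) ^+ (n + i)) ^+ 2 * (x * y)) by ring.
  by rewrite sqrr_sign mul1r oppr_lt0 mulr_gt0.
- move=> s /mapP[i]; rewrite mem_iota add0n ltnS /= => i_n ->; split; first exact: t01.
  by rewrite tb // normrMsign gtr0_norm // hF // t01.
Qed.

Lemma feasible_sign (R : realType) (n : nat) (alpha a b : nat -> R) (k : R) :
  `|k| = 1 -> feasible n alpha a b -> feasible n alpha a (fun i => k * b i).
Proof.
by move=> k1 fb s s01; rewrite homogZ normrM k1 mul1r fb.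
Qed.

(** Adjacent signs are opposite, so making the value at 1 positive fixes all. *)
Lemma touching_alternates (R : realType) (n : nat) (alpha a b : nat -> R)
    (ss : seq R) :
    (0 < n)%N -> (forall i, (i < n)%N -> alpha i < alpha i.+1) ->
    alpha 0%N = 0 -> (forall s, 0 <= s <= 1 -> 0 < homog n alpha a s) ->
    feasible n alpha a b -> touching n alpha a b ss ->
  exists k, `|k| = 1 /\ alternates n alpha a (fun i => k * b i) (nth 0 ss).
Proof.
move=> n0 incr a0 hF fb tb; have [ss0 ss1] := touching_ends n0 incr a0 hF fb tb.
have [sss srt hss] := tb.
have ssi i : (i < n)%N -> (nth 0 ss i < nth 0 ss i.+1) &&
    (homog n alpha b (nth 0 ss i) * homog n alpha b (nth 0 ss i.+1) < 0).
  by move=> i_n; apply: (sortedP 0 srt); rewrite sss.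
have inc i : (i < n)%N -> nth 0 ss i < nth 0 ss i.+1 by move=> /ssi/andP[].
have mem i : (i <= n)%N -> nth 0 ss i \in ss by move=> i_n; rewrite mem_nth // sss.
have t0 : nth 0 ss 0 = 0.
  have i0 : (index 0%R ss <= n)%N by rewrite -ltnS -sss index_mem.
  apply/eqP; rewrite eq_le -{2}(nth_index 0 ss0) (incr_le inc) //=.
  by have [/andP[]] := hss _ (mem 0%N (leq0n n)).
have tn : nth 0 ss n = 1.
  have i1 : (index 1%R ss <= n)%N by rewrite -ltnS -sss index_mem.
  apply/eqP; rewrite eq_le -{2}(nth_index 0 ss1) (incr_le inc) // andbT.
  by have [/andP[]] := hss _ (mem n (leqnn n)).
have [k [k1 hk]] : exists k : R, `|k| = 1 /\ k * homog n alpha b 1 = homog n alpha a 1.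
  have [_ <-] := hss 1 ss1; have [hb|hb] := leP 0 (homog n alpha b 1).
    by exists 1; rewrite normr1 mul1r ger0_norm.
  by exists (- 1); rewrite normrN normr1 mulN1r ltr0_norm.
exists k; split => //; split => //; first exact: feasible_sign.
suff H j i : (i + j = n)%N -> k * homog n alpha b (nth 0 ss i)
    = (-1) ^+ j * homog n alpha a (nth 0 ss i).
  move=> i i_n; rewrite homogZ (H (n - i)%N) ?subnKC //.
  congr (_ * _); rewrite -signr_odd -[RHS]signr_odd; congr (_ ^+ nat_of_bool _).
  by rewrite oddD oddB.
elim: j i => [|j IH] i; first by rewrite addn0 => ->; rewrite tn hk expr0 mul1r.
move=> ij; have i_n : (i < n)%N by lia.
have := IH i.+1; rewrite addSnnS => /(_ ij) e.
have /andP[_ neg] := ssi i i_n.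
have [i01 hi] := hss _ (mem i (ltnW i_n)).
have F0 := hF _ i01; have [i01' _] := hss _ (mem i.+1 i_n).
have F1 := hF _ i01'.
move: neg e hi F0 F1.
set P0 := homog n alpha b (nth 0 ss i); set P1 := homog n alpha b (nth 0 ss i.+1).
set G0 := homog n alpha a (nth 0 ss i); set G1 := homog n alpha a (nth 0 ss i.+1).
move=> neg e hi g0 g1.
have kk := norm1_sqr k1.
have ss2 : (-1) ^+ j * (-1) ^+ j = 1 :> R by rewrite -expr2 sqrr_sign.
rewrite exprS mulN1r mulNr.
have {}hi : `|k * P0| = G0 by rewrite normrM k1 mul1r.
have : (k * P0) * ((-1) ^+ j * G1) < 0.
  rewrite -e; have -> : k * P0 * (k * P1) = (k * k) * (P0 * P1) by ring.
  by rewrite kk mul1r.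
have : `|(-1) ^+ j * (k * P0)| = G0 by rewrite normrMsign.
case: (ger0P ((-1) ^+ j * (k * P0))) => h e'.
  have -> : k * P0 * ((-1) ^+ j * G1) = (-1) ^+ j * (k * P0) * G1 by ring.
  by rewrite ltNge mulr_ge0 // ltW.
by move=> _; rewrite -e' mulrN opprK mulrA ss2 mul1r.
Qed.

(** This makes the extremal value positive, so that signs can be normalized by
    it. *)
Lemma feasible_small (R : realType) (n : nat) (alpha a : nat -> R) :
    (forall i, (i < n)%N -> alpha i < alpha i.+1) -> alpha 0%N = 0 ->
    (forall s, 0 <= s <= 1 -> 0 < homog n alpha a s) ->
  exists2 e : R, 0 < e & feasible n alpha a (fun i => e * (i == 1%N)%:R).
Proof.
move=> incr a0 hF.
have a0' : 0 <= alpha 0%N by rewrite a0.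
have c1 := homog_continuous (b := fun i => (i == 1%N)%:R) incr a0'.
have cF := homog_continuous (b := a) incr a0'.
have cn : continuous (fun s => `|homog n alpha (fun i => (i == 1%N)%:R) s|).
  move=> s; apply: (@continuous_comp _ _ _ _ (fun x : R => `|x|)); first exact: c1.
  exact: norm_continuous.
have [x x01 xmax] := EVT_max ler01 (continuous_within (a := 0) (b := 1) cn).
have [y y01 ymin] := EVT_min ler01 (continuous_within (a := 0) (b := 1) cF).
have Fy : 0 < homog n alpha a y by apply: hF; rewrite in_itv in y01.
move: xmax ymin; set M := `|_| => xmax; set m := homog n alpha a y => ymin.
have M0 : 0 <= M by exact: normr_ge0.
exists (m / (M + 1)); first by rewrite divr_gt0 //; lra.
move=> s s01; have s01' : s \in `[0, 1]%R by rewrite in_itv.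
rewrite (homogZ _ _ (fun i => (i == 1%N)%:R)) normrM gtr0_norm.
  have h1 := xmax s s01'; have h2 := ymin s s01'.
  apply: le_trans h2; rewrite mulrAC ler_pdivrMr; last lra.
  by apply: ler_pM => //; [exact: ltW|apply: le_trans h1 _; lra].
by rewrite divr_gt0 //; lra.
Qed.

Lemma alternates_coef1 (R : realType) (n : nat) (alpha a b : nat -> R) (t : nat -> R) :
    (0 < n)%N -> (forall i, (i < n)%N -> alpha i < alpha i.+1) ->
    alpha 0%N = 0 -> (forall s, 0 <= s <= 1 -> 0 < homog n alpha a s) ->
    alternates n alpha a b t -> b 1%N != 0.
Proof.
move=> n0 incr a0 hF /(alternates_touching incr a0 hF) tb.
have [e e0 fe] := feasible_small incr a0 hF.
have := touching_extremal n0 incr a0 hF tb fe.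
rewrite eqxx mulr1 gtr0_norm // => h.
by rewrite -normr_gt0 (lt_le_trans e0 h).
Qed.

Lemma exists_alternates (R : realType) (n : nat) (alpha a : nat -> R) :
    (0 < n)%N -> (forall i, (i < n)%N -> alpha i < alpha i.+1) ->
    alpha 0%N = 0 -> (forall s, 0 <= s <= 1 -> 0 < homog n alpha a s) ->
  exists b t, alternates n alpha a b t.
Proof.
move=> n0 incr a0 hF; have [n1|n1] := ltnP 1 n.
  have [b [fb bmax]] := exists_maximizer n0 incr a0 hF.
  have [e e0 fe] := feasible_small incr a0 hF.
  have b1 : 0 < b 1%N.
    by have := bmax _ fe; rewrite eqxx mulr1; exact: lt_le_trans.
  have [ss tss] := maximizer_touching n1 incr a0 hF fb b1 bmax.
  have [k [_ alt]] := touching_alternates n0 incr a0 hF fb tss.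
  by exists (fun i => k * b i), (nth 0 ss).
have {n1 n0} n1 : n = 1%N by lia.
(* for two terms the values at 0 and oo are the coefficients *)
subst n; exists (fun i => if i == 0%N then - a 0%N else a i), (fun i => i%:R).
have a00 : 0 < a 0%N by rewrite -(homog0 a incr a0) hF // lexx ler01.
have a11 : 0 < a 1%N by rewrite -(homog1 a incr) hF // lexx ler01.
split => //.
- move=> s s01; rewrite /homog !big_ord_recl !big_ord0 /= !addr0 mulNr.
  set u := _ * _; set v := _ * _.
  have u0 : 0 <= u by rewrite /u !mulr_ge0 ?powR_ge0 // ltW.
  have v0 : 0 <= v by rewrite /v !mulr_ge0 ?powR_ge0 // ltW.
  by rewrite ler_norml; apply/andP; split; lra.
- by move=> [|//] _; rewrite ltr01.
- move=> [|[|//]] _.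
    by rewrite (homog0 _ incr a0) (homog0 _ incr a0) /= expr1 mulN1r.
  by rewrite (homog1 _ incr) (homog1 _ incr) /= sqrrN expr1n mul1r.
Qed.

(** Two alternating polynomials are both extremal, hence so is their mean (after
    adjusting signs); where the mean touches, both of them do, and n + 1 common
    values force equality. *)
Lemma alternates_unique (R : realType) (n : nat) (alpha a b c : nat -> R)
    (t u : nat -> R) :
    (0 < n)%N -> (forall i, (i < n)%N -> alpha i < alpha i.+1) ->
    alpha 0%N = 0 -> (forall s, 0 <= s <= 1 -> 0 < homog n alpha a s) ->
    alternates n alpha a b t -> alternates n alpha a c u ->
  forall i, (i <= n)%N -> b i = c i.
Proof.
move=> n0 incr a0 hF altb altc.
have [fb t0 tn ti tb] := altb; have [fc u0 un ui uc] := altc.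
have bn : b n = c n.
  by rewrite -!(homog1 _ incr) -{1}tn -un tb // uc // tn un.
have bn0 : b n != 0.
  rewrite -(homog1 _ incr) -tn tb // mulf_neq0 ?signr_eq0 //.
  by rewrite gt_eqF // tn hF // lexx ler01.
have [n1|n1] := ltnP 1 n; last first.
  have b0 : b 0%N = c 0%N.
    by rewrite -!(homog0 _ incr a0) -{1}t0 -u0 tb // uc // t0 u0.
  by move=> [//|[|i]] i_n; [have -> : 1%N = n by lia|exfalso; lia].
have sb := alternates_touching incr a0 hF altb.
have sc := alternates_touching incr a0 hF altc.
have b1 := alternates_coef1 n0 incr a0 hF altb.
have bc1 : `|b 1%N| = `|c 1%N|.
  by apply/eqP; rewrite eq_le !(touching_extremal n0 incr a0 hF sb fc,
    touching_extremal n0 incr a0 hF sc fb).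
have c1 : c 1%N != 0 by rewrite -normr_gt0 -bc1 normr_gt0.
have [k [k1 kb]] : exists k, `|k| = 1 /\ k * b 1%N = `|b 1%N|.
  have [h|h] := leP 0 (b 1%N); first by exists 1; rewrite normr1 mul1r ger0_norm.
  by exists (- 1); rewrite normrN normr1 mulN1r ltr0_norm.
have [l [l1 lc]] : exists l, `|l| = 1 /\ l * c 1%N = `|b 1%N|.
  rewrite bc1; have [h|h] := leP 0 (c 1%N); first by exists 1; rewrite normr1 mul1r ger0_norm.
  by exists (- 1); rewrite normrN normr1 mulN1r ltr0_norm.
pose r i := (k / 2) * b i + (l / 2) * c i.
have r1 : r 1%N = `|b 1%N|.
  rewrite /r; have -> : k / 2 * b 1%N + l / 2 * c 1%N = (k * b 1%N + l * c 1%N) / 2 by field.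
  by rewrite kb lc; field.
have rE s : homog n alpha r s = (k * homog n alpha b s + l * homog n alpha c s) / 2.
  by rewrite homog_lin; field.
have kbF s : 0 <= s <= 1 -> `|k * homog n alpha b s| <= homog n alpha a s.
  by move=> s01; rewrite normrM k1 mul1r fb.
have lcF s : 0 <= s <= 1 -> `|l * homog n alpha c s| <= homog n alpha a s.
  by move=> s01; rewrite normrM l1 mul1r fc.
have fr : feasible n alpha a r.
  move=> s s01; have := kbF s s01; have := lcF s s01; rewrite rE !ler_norml.
  by move=> /andP[? ?] /andP[? ?]; apply/andP; split; lra.
have [|d fd|ss [sss srt hss]] := maximizer_touching n1 incr a0 hF fr.
- by rewrite r1 normr_gt0.
- rewrite r1; apply: le_trans (ler_norm _) _.
  exact: touching_extremal n0 incr a0 hF sb fd.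
have eq_ss s : s \in ss -> k * homog n alpha b s = l * homog n alpha c s.
  move=> /hss[s01]; have := kbF s s01; have := lcF s s01; rewrite rE.
  have := hF s s01; rewrite !ler_norml => F0 /andP[? ?] /andP[? ?].
  by case: (ger0P ((k * homog n alpha b s + l * homog n alpha c s) / 2)) => _ e; lra.
have uss : uniq ss.
  have : sorted <%R ss.
    by case: (ss) srt => //= x v; apply: sub_path => y z /andP[].
  by apply: sorted_uniq; [exact: lt_trans|exact: ltxx].
have kblc i : (i <= n)%N -> k * b i = l * c i.
  move=> i_n; apply/eqP; rewrite -subr_eq0; apply/negPn/negP => ne.
  have := @closed_zeros R n alpha (fun i => k * b i + (- l) * c i) ss n0 incr a0.
  rewrite sss ltnn => H; suff : false by [].
  apply: H => //; first by exists i => //; rewrite mulNr.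
  move=> s sss'; have [s01 _] := hss s sss'; split => //.
  by rewrite homog_lin mulNr eq_ss // subrr.
have kl : k = l by have := kblc n (leqnn n); rewrite bn; apply: mulIf; rewrite -bn.
move=> i i_n; have := kblc i i_n; rewrite kl; apply: mulfI.
by rewrite -normr_gt0 l1.
Qed.
(** * Confluent determinants *)

Definition mono_row (R : realType) (al z : nat -> R) (i j : nat) : R :=
  if odd i then derive1 (fun t : R => t `^ al j) (z i./2.+1)
  else z i./2.+1 `^ al j.

(** The rows of points z_1, z_1, z_2, z_2, ... of the confluent matrix, with any
    number k of them, so that an induction can add a single row. *)
Definition mono_mx (R : realType) (k : nat) (al z : nat -> R) : 'M[R]_k :=
  \matrix_(i, j) mono_row al z i j.

(** The value at oo is the positive leading coefficient, so a negative value at T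
    would force a zero beyond T. *)
Lemma lincomb_top_gt0 (R : realType) (n : nat) (al b : nat -> R) (T : R) :
    (forall i, (i < n)%N -> al i < al i.+1) -> 0 <= al 0%N -> 0 < b n -> 0 < T ->
    (forall t, T <= t -> lincomb n al b t != 0) ->
  0 < lincomb n al b T.
Proof.
move=> incr a0 bn T0 h; rewrite lt_neqAle eq_sym h //= leNgt; apply/negP => gT.
have cb := homog_continuous (b := b) incr a0.
have /andP[s0 s1] := of_half_line_itv (ltW T0).
have : homog n al b (of_half_line T) * homog n al b 1 < 0.
  rewrite homog1 // pmulr_llt0 // homog_of_half_line ?(ltW T0) // pmulr_rlt0 //.
  by rewrite of_half_line_gt0 // ltW.
move=> /(ivt_zero cb s1)[z /andP[sz z1] hz].
have z0 : 0 <= z by rewrite ltW // (le_lt_trans s0 sz).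
have /negP[] : lincomb n al b (to_half_line z) != 0.
  apply: h; rewrite ltW // -lt_of_half_line //; exact: ltW.
by rewrite -homog_eq0 ?hz // z0.
Qed.

Lemma derive_ge0_right (R : realType) (f : R -> R) (x df : R) :
  is_derive x 1 f df -> f x = 0 -> (forall y, x < y -> 0 <= f y) -> 0 <= df.
Proof.
move=> [dfx <-] fx0 f0; rewrite leNgt; apply/negP => d0.
have : \forall h \near dnbhs (0 : R), h^-1 *: (f (h *: 1 + x) - f x) < 0.
  by have /cvgr_lt/(_ 0 d0) := dfx.
rewrite near_withinE => /nbhs_ballP[e /= e0 he].
have e2 : 0 < e / 2 by rewrite divr_gt0.
have := he (e / 2); rewrite /ball /= sub0r normrN gtr0_norm //.
have -> : e / 2 < e by lra.
move=> /(_ isT (lt0r_neq0 e2)); rewrite fx0 subr0 /GRing.scale /= mulr1.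
rewrite pmulr_rlt0 ?invr_gt0 // ltNge f0 //; lra.
Qed.

Lemma sum_mono_row (R : realType) (n : nat) (al z b : nat -> R) (i : nat) :
    0 < z i./2.+1 ->
  \sum_(j < n.+1) mono_row al z i j * b j
  = if odd i then dlincomb n al b (z i./2.+1) else lincomb n al b (z i./2.+1).
Proof.
move=> zi; rewrite /mono_row; case: odd; apply: eq_bigr => j _; rewrite mulrC //.
by rewrite powR_derive1 // in_itv /= zi.
Qed.

Lemma points_lt (R : realType) (r : nat) (z : nat -> R) :
    (forall i, (0 < i < r)%N -> z i < z i.+1) ->
  forall i j, (0 < i)%N -> (i < j)%N -> (j <= r)%N -> z i < z j.
Proof.
move=> zi i j i0; elim: j => // j IHj; rewrite ltnS leq_eqVlt => /orP[/eqP<-|ij] jr.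
  by apply: zi; lia.
by apply: lt_trans (IHj ij _) (zi _ _); lia.
Qed.

Lemma points_inj (R : realType) (r : nat) (z : nat -> R) :
    (forall i, (0 < i < r)%N -> z i < z i.+1) ->
  forall i j, (0 < i <= r)%N -> (0 < j <= r)%N -> z i = z j -> i = j.
Proof.
move=> zi i j ir jr e; have [ij|ji|//] := ltngtP i j.
  by have : z i < z j by [apply: (points_lt zi); lia]; rewrite e ltxx.
by have : z j < z i by [apply: (points_lt zi); lia]; rewrite e ltxx.
Qed.

(** The minors are positive by induction on the size: expanded along the last
    row, the determinant is the value, or the derivative, at the last point of a
    polynomial whose zeros at the earlier rows are all that Descartes' bound
    permits and whose leading coefficient is the previous minor. *)
Lemma det_mono_mx_gt0 (R : realType) (r : nat) (al z : nat -> R) (k : nat) :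
    (forall i, (i < r.*2)%N -> al i < al i.+1) -> 0 <= al 0%N ->
    (forall i, (0 < i <= r)%N -> 0 < z i) ->
    (forall i, (0 < i < r)%N -> z i < z i.+1) ->
    (k <= r.*2)%N ->
  0 < \det (mono_mx k al z).
Proof.
move=> incr a0 z0 zi; elim: k => [|k IH] kr; first by rewrite det_mx00.
have {}IH := IH (ltnW kr).
have incrk i : (i < k)%N -> al i < al i.+1 by move=> ik; apply: incr; lia.
pose M := mono_mx k.+1 al z.
pose b (j : nat) : R := cofactor M ord_max (inord j).
have bk : 0 < b k.
  rewrite /b (_ : inord k = ord_max); last by apply/val_inj; rewrite /= inordK.
  rewrite /cofactor -signr_odd oddD addbb expr0 mul1r.
  have -> : row' ord_max (col' ord_max M) = mono_mx k al z :> 'M[R]_k; last exact: IH.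
  apply/matrixP => i j; rewrite !mxE; congr (mono_row _ _ _ _);
  by rewrite /= /bump leqNgt ltn_ord.
have zpos i : (i <= k)%N -> 0 < z i./2.+1.
  by move=> ik; apply: z0; lia.
have rowE (i : 'I_k.+1) : \sum_(j < k.+1) mono_row al z i j * b j
    = if i == ord_max then \det M else 0.
  have := congr1 (fun A : 'M[R]_k.+1 => A i ord_max) (mul_mx_adj M).
  rewrite !mxE => H; transitivity (\det M *+ (i == ord_max)); last by case: eqP.
  rewrite -H; apply: eq_bigr => j _.
  by rewrite /b inord_val !mxE.
have g0 i : (i < k)%N ->
    (if odd i then dlincomb k al b (z i./2.+1) else lincomb k al b (z i./2.+1)) = 0.
  move=> ik; rewrite -sum_mono_row; last by apply: zpos; exact: ltnW.
  have := rowE (inord i); rewrite -val_eqE /= inordK ?ltn_eqF //; last exact: ltnW.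
have gk : (if odd k then dlincomb k al b (z k./2.+1) else lincomb k al b (z k./2.+1))
    = \det M.
  by rewrite -sum_mono_row ?zpos //; have := rowE ord_max; rewrite eqxx.
have zlt := points_lt zi; have zinj := points_inj zi.
pose zs q := [seq z i.+1 | i <- iota 0 q].
have uzs q : (q <= r)%N -> uniq (zs q).
  move=> qr; rewrite map_inj_in_uniq ?iota_uniq // => i j.
  by rewrite !mem_iota => ir jr /zinj H; apply: succn_inj; apply: H; lia.
have hzs x : x \in zs (uphalf k) -> 0 < x /\ lincomb k al b x = 0.
  move=> /mapP[i]; rewrite mem_iota => ik ->; split; first by apply: z0; lia.
  have := g0 i.*2; rewrite odd_double doubleK; apply; lia.
have hds x : x \in zs k./2 -> dlincomb k al b x = 0.
  move=> /mapP[i]; rewrite mem_iota => ik ->.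
  have := g0 i.*2.+1; rewrite /= odd_double /= uphalf_double; apply; lia.
have bne : exists2 i, (i <= k)%N & b i != 0 by exists k => //; rewrite gt_eqF.
have suppb : (supp k b <= k.+1)%N.
  by rewrite /supp -[X in (_ <= X)%N](card_ord k.+1) max_card.
have sub p q : (p <= q)%N -> {subset zs p <= zs q}.
  move=> pq x /mapP[i]; rewrite mem_iota => ip ->; apply: map_f.
  by rewrite mem_iota; lia.
(* the zeros coming from the first k rows exhaust Descartes' bound *)
have nozero x : 0 < x -> x \notin zs (uphalf k) -> lincomb k al b x != 0.
  move=> x0 xz; apply/negP => /eqP gx.
  have := @lincomb_zeros R k al b (x :: zs (uphalf k)) (zs k./2) incrk bne.
  rewrite /= xz uzs ?uzs; [|lia|lia] => /(_ isT isT) H.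
  suff : ((size (zs (uphalf k))).+1 + size (zs k./2) < supp k b)%N.
    by rewrite !size_map !size_iota; move: (supp k b) suppb => N; lia.
  apply: H => //.
    by move=> y /(@sub _ (uphalf k)) yz; rewrite in_cons yz ?orbT //; lia.
  by move=> y; rewrite in_cons => /orP[/eqP->|/hzs].
have beyond x : z k./2.+1 < x -> x \notin zs (uphalf k).
  move=> zx; apply/negP => /mapP[i]; rewrite mem_iota => ik xE.
  have [e|ne] := eqVneq i k./2; first by rewrite xE e ltxx in zx.
  have := zlt i.+1 k./2.+1; rewrite -xE => H.
  by have : x < z k./2.+1 by [apply: H; lia]; rewrite ltNge (ltW zx).
rewrite -/M -gk; case: ifPn => ko; last first.
  apply: lincomb_top_gt0 => //; first exact: zpos.
  move=> t zt; apply: nozero; first exact: lt_le_trans (zpos k (leqnn k)) zt.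
  move: zt; rewrite le_eqVlt => /orP[/eqP<-|]; last exact: beyond.
  apply/negP => /mapP[i]; rewrite mem_iota => ik /zinj H.
  by have := H; lia.
have Zz : z k./2.+1 \in zs (uphalf k).
  by apply: map_f; rewrite mem_iota; lia.
have [Z0 gZ] := hzs _ Zz.
have dZ : dlincomb k al b (z k./2.+1) != 0.
  apply/negP => /eqP dgx.
  have := @lincomb_zeros R k al b (zs (uphalf k)) (zs (uphalf k)) incrk bne.
  rewrite uzs; last lia.
  move=> /(_ isT isT) H.
  suff : (size (zs (uphalf k)) + size (zs (uphalf k)) < supp k b)%N.
    by rewrite !size_map !size_iota; move: (supp k b) suppb => N; lia.
  apply: H => // x /mapP[i]; rewrite mem_iota => ik ->.
  have [->//|ne] := eqVneq i k./2.
  by apply: hds; apply: map_f; rewrite mem_iota; lia.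
rewrite lt_neqAle eq_sym dZ /=.
apply: (derive_ge0_right (is_derive_lincomb k al b Z0) gZ) => y Zy; apply: ltW.
apply: lincomb_top_gt0 => //; first exact: lt_trans Zy.
move=> t yt; apply: nozero; first by apply: lt_le_trans yt; exact: lt_trans Zy.
by apply: beyond; exact: lt_le_trans yt.
Qed.
Lemma confluent_leadE (R : realType) (r : nat) (al z : nat -> R) (t : R) :
  confluent_lead r al z t = \det (mono_mx r.*2 al z).
Proof.
rewrite /confluent_lead /cofactor -signr_odd /= odd_double expr0 mul1r.
congr (\det _); apply/matrixP => i j; rewrite !mxE /mono_row /=.
have -> : bump r.*2 j = j by rewrite /bump leqNgt ltn_ord.
rewrite uphalf_half; case: odd => /=; rewrite ?add1n ?add0n //.
Qed.

(** The matrix at the point 0 serves for all points, as row 0 is deleted. *)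
Definition det_coef (R : realType) (r : nat) (al z : nat -> R) (j : nat) : R :=
  cofactor (confluent_mx r al z 0) ord0 (inord j).

Lemma cofactor_confluent (R : realType) (r : nat) (al z : nat -> R) (t : R)
    (j : 'I_r.*2.+1) :
  cofactor (confluent_mx r al z t) ord0 j = det_coef r al z j.
Proof.
rewrite /det_coef inord_val /cofactor; congr (_ * \det _).
by apply/matrixP => k l; rewrite !mxE.
Qed.

Lemma det_confluentE (R : realType) (r : nat) (al z : nat -> R) (t : R) :
  \det (confluent_mx r al z t) = lincomb r.*2 al (det_coef r al z) t.
Proof.
rewrite (expand_det_row _ ord0); apply: eq_bigr => j _.
by rewrite cofactor_confluent !mxE mulrC.
Qed.

Lemma det_coef_top (R : realType) (r : nat) (al z : nat -> R) :
  det_coef r al z r.*2 = \det (mono_mx r.*2 al z).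
Proof.
rewrite -(confluent_leadE _ _ _ 0) /confluent_lead cofactor_confluent //.
Qed.

Lemma det_coef_zero (R : realType) (r : nat) (al z : nat -> R) (i : nat) :
    (0 < i <= r)%N -> 0 < z i ->
  lincomb r.*2 al (det_coef r al z) (z i) = 0
  /\ dlincomb r.*2 al (det_coef r al z) (z i) = 0.
Proof.
move=> ir zi.
have row (k : 'I_r.*2.+1) : k != ord0 ->
    \sum_(j < r.*2.+1) confluent_mx r al z 0 k j * det_coef r al z j = 0.
  move=> k0; have := congr1 (fun A : 'M[R]_r.*2.+1 => A k ord0)
    (mul_mx_adj (confluent_mx r al z 0)).
  rewrite !mxE (negPf k0) mulr0n => H; rewrite -[RHS]H; apply: eq_bigr => j _.
  by rewrite [X in _ = _ * X]mxE cofactor_confluent.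
have o1 : (i.*2.-1 < r.*2.+1)%N by lia.
have o2 : (i.*2 < r.*2.+1)%N by lia.
have := row (Ordinal o1); have := row (Ordinal o2).
rewrite -!val_eqE /= !(gtn_eqF, double_eq0) //; try lia.
have [i0 i1] : (i.*2 != 0)%N /\ (i.*2.-1 != 0)%N by split; lia.
move=> /(_ isT) H2 /(_ isT) H1; split.
- rewrite -[RHS]H1; apply: eq_bigr => j _; rewrite !mxE /= (negPf i1).
  have -> : odd i.*2.-1 by lia.
  have -> : uphalf i.*2.-1 = i by rewrite uphalf_half; lia.
  exact: mulrC.
- rewrite -[RHS]H2; apply: eq_bigr => j _; rewrite !mxE /= (negPf i0).
  rewrite odd_double doubleK mulrC powR_derive1 // in_itv /= zi //.
Qed.

Lemma nonneg_derive0 (R : realType) (n : nat) (al g : nat -> R) (z : R) :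
    (forall t, 0 <= t -> 0 <= lincomb n al g t) -> 0 < z ->
    lincomb n al g z = 0 -> dlincomb n al g z = 0.
Proof.
move=> g0 z0 gz.
have D := is_derive_lincomb n al g z0.
have D0 : is_derive z 1 (lincomb n al g) 0.
  apply: (@derive1_at_min R _ 0 (z + z)).
  - by rewrite addr_ge0 // ltW.
  - move=> t; rewrite in_itv /= => /andP[t0 _].
    by have := is_derive_lincomb n al g t0 => -[].
  - by rewrite in_itv /= z0 ltrDl.
  - by move=> t; rewrite in_itv /= => /andP[t0 _]; rewrite gz g0 // ltW.
by have [_ <-] := D; have [_ <-] := D0.
Qed.

Lemma lincomb_eq0_coef (R : realType) (n : nat) (al b : nat -> R) :
    (forall i, (i < n)%N -> al i < al i.+1) ->
    (forall t, 0 <= t -> lincomb n al b t = 0) ->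
  forall i, (i <= n)%N -> b i = 0.
Proof.
move=> incr b0 i i_n; apply/eqP/negPn/negP => bi.
have := @lincomb_zeros R n al b [seq j.+1%:R | j <- iota 0 n.+1] [::] incr.
rewrite size_map size_iota addn0 => H.
suff : (n.+1 < supp n b)%N.
  rewrite ltnNge; move=> /negP; apply.
  by rewrite /supp -[X in (_ <= X)%N](card_ord n.+1) max_card.
apply: H => //; first by exists i.
- rewrite map_inj_uniq ?iota_uniq // => j k /eqP.
  by rewrite eqr_nat eqSS => /eqP.
- by move=> x /mapP[j _ ->]; rewrite ltr0Sn b0 // ltW.
Qed.

(** By nonnegativity the r zeros are double, so Descartes' bound admits neither a
    further positive zero nor a vanishing coefficient.  After scaling to equal
    leading coefficients, the difference with the confluent determinant has 2r
    terms and still r double zeros, hence is 0. *)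
Lemma det_form (R : realType) (r : nat) (al z g : nat -> R) :
    (forall i, (i < r.*2)%N -> al i < al i.+1) -> 0 <= al 0%N ->
    (forall i, (0 < i <= r)%N -> 0 < z i) ->
    (forall i, (0 < i < r)%N -> z i < z i.+1) ->
    (exists2 i, (i <= r.*2)%N & g i != 0) ->
    (forall t, 0 <= t -> 0 <= lincomb r.*2 al g t) ->
    (forall i, (0 < i <= r)%N -> lincomb r.*2 al g (z i) = 0) ->
  [/\ 0 < g r.*2, (forall t, 0 < confluent_lead r al z t),
      (forall i, (i <= r.*2)%N -> g i != 0),
      (forall t, 0 < t -> lincomb r.*2 al g t = 0 ->
         exists2 i, (0 < i <= r)%N & t = z i)
    & forall t, lincomb r.*2 al g t
        = g r.*2 / confluent_lead r al z t * \det (confluent_mx r al z t)].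
Proof.
move=> incr a0 z0 zi gne g0 gz.
have lead t : 0 < confluent_lead r al z t.
  by rewrite confluent_leadE; exact: (@det_mono_mx_gt0 R r).
have zinj := points_inj zi.
pose zs := [seq z i | i <- iota 1 r].
have szs : size zs = r by rewrite size_map size_iota.
have uzs : uniq zs.
  rewrite map_inj_in_uniq ?iota_uniq // => i j.
  by rewrite !mem_iota => ir jr; apply: zinj; lia.
have zsP x : x \in zs -> exists2 i, (0 < i <= r)%N & x = z i.
  by move=> /mapP[i]; rewrite mem_iota => ir ->; exists i => //; lia.
have count (h : nat -> R) : (exists2 i, (i <= r.*2)%N & h i != 0) ->
    (forall i, (0 < i <= r)%N ->
       lincomb r.*2 al h (z i) = 0 /\ dlincomb r.*2 al h (z i) = 0) ->
    (r.*2 < supp r.*2 h)%N.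
  move=> hne hz; rewrite -[X in (X < _)%N]addnn -{1 2}szs.
  apply: (lincomb_zeros incr hne uzs uzs) => //.
    by move=> x /zsP[i ir ->]; rewrite z0 //; have [] := hz i ir.
  by move=> x /zsP[i ir ->]; have [] := hz i ir.
have gz' i : (0 < i <= r)%N ->
    lincomb r.*2 al g (z i) = 0 /\ dlincomb r.*2 al g (z i) = 0.
  by move=> ir; split; [exact: gz|apply: nonneg_derive0 => //; [exact: z0|exact: gz]].
have gall i : (i <= r.*2)%N -> g i != 0.
  move=> ir; apply/negP => /eqP gi.
  have := @supp_le R r.*2 g [:: i] isT; have := count g gne gz'.
  move: (supp _ _) => N /= NN H; suff : (N + 1 <= r.*2.+1)%N by lia.
  by apply: H => j; rewrite inE => /eqP->.
have gtop : 0 < g r.*2.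
  rewrite lt_neqAle eq_sym gall //= -(homog1 g incr).
  by apply: (homog_ge0 incr a0 g0); rewrite ler01 lexx.
split => //.
- move=> t t0 gt; have [/zsP//|tz] := boolP (t \in zs).
  have := @lincomb_zeros R r.*2 al g (t :: zs) zs incr gne.
  rewrite /= tz uzs => /(_ isT isT) H.
  have : ((size zs).+1 + size zs < supp r.*2 g)%N.
    apply: H => //.
    - by move=> x xz; rewrite in_cons xz orbT.
    - move=> x; rewrite in_cons => /orP[/eqP->//|/zsP[i ir ->]].
      by rewrite z0 // gz.
    - by move=> x /zsP[i ir ->]; have [] := gz' i ir.
  rewrite szs; have : (supp r.*2 g <= r.*2.+1)%N.
    by rewrite /supp -[X in (_ <= X)%N](card_ord r.*2.+1) max_card.
  by move: (supp _ _) => N; lia.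
- move=> t; rewrite det_confluentE.
  set L := confluent_lead r al z t; set c := det_coef r al z.
  have L0 : L != 0 by rewrite gt_eqF // lead.
  have cL : c r.*2 = L by rewrite /L confluent_leadE /c det_coef_top.
  (* h has no leading term, but the r double zeros common to g and c *)
pose h i := L * g i + (- g r.*2) * c i.
  have hlin x : lincomb r.*2 al h x
      = L * lincomb r.*2 al g x - g r.*2 * lincomb r.*2 al c x.
    by rewrite /h lincomb_lin mulNr.
  have dhlin x : dlincomb r.*2 al h x
      = L * dlincomb r.*2 al g x - g r.*2 * dlincomb r.*2 al c x.
    rewrite /dlincomb !mulr_sumr -sumrB; apply: eq_bigr => i _.
    by rewrite /h; ring.
  have h_zero i : (i <= r.*2)%N -> h i = 0.
    move=> ir; apply/eqP/negPn/negP => hi.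
    have hne : exists2 i, (i <= r.*2)%N & h i != 0 by exists i.
    have htop : h r.*2 = 0 by rewrite /h cL; ring.
    have := @supp_le R r.*2 h [:: r.*2] isT.
    have hz j : (0 < j <= r)%N ->
        lincomb r.*2 al h (z j) = 0 /\ dlincomb r.*2 al h (z j) = 0.
      move=> jr; rewrite hlin dhlin; have [-> ->] := gz' j jr.
      have [-> ->] := det_coef_zero al jr (z0 j jr).
      by rewrite !mulr0 subrr.
    have := count h hne hz.
    move: (supp _ _) => N /= NN H; suff : (N + 1 <= r.*2.+1)%N by lia.
    by apply: H => j; rewrite inE => /eqP->.
  have : lincomb r.*2 al h t = 0.
    by rewrite /lincomb big1 // => i _; rewrite h_zero ?mul0r // leq_ord.
  rewrite hlin => /eqP; rewrite subr_eq0 => /eqP e.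
  by rewrite mulrAC -e mulrAC divff // mul1r.
Qed.
(** * Alternating polynomials and decompositions *)

Lemma lincomb_shift (R : realType) (n : nat) (al c : nat -> R) (t : R) :
  c 0%N = 0 ->
  lincomb n.+1 al c t = lincomb n (fun j => al j.+1) (fun j => c j.+1) t.
Proof. by move=> c0; rewrite /lincomb big_ord_recl c0 mul0r add0r. Qed.

Lemma lincomb_trunc (R : realType) (n : nat) (al c : nat -> R) (t : R) :
  c n.+1 = 0 -> lincomb n.+1 al c t = lincomb n al c t.
Proof. by move=> c0; rewrite /lincomb big_ord_recr /= c0 mul0r addr0. Qed.

Lemma lincomb_at0 (R : realType) (n : nat) (al c : nat -> R) :
    (forall i, (i < n)%N -> al i < al i.+1) -> al 0%N = 0 ->
  lincomb n al c 0 = c 0%N.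
Proof.
move=> incr a0; rewrite /lincomb big_ord_recl a0 powRr0 mulr1 big1 ?addr0 //.
move=> i _; rewrite powR0 ?mulr0 // gt_eqF // -a0 (incr_lt incr) //.
exact: ltn_ord.
Qed.

Section Decomposition.
Variables (R : realType) (n : nat) (alpha a b t : nat -> R).
Hypotheses (n0 : (0 < n)%N)
  (incr : forall i, (i < n)%N -> alpha i < alpha i.+1) (a0 : alpha 0%N = 0)
  (hF : forall s, 0 <= s <= 1 -> 0 < homog n alpha a s)
  (han : 0 < a n) (alt : alternates n alpha a b t).

(** The part lo vanishes where b meets - a, the part up where b meets a. *)
Let lo (i : nat) : R := 2^-1 * a i + 2^-1 * b i.
Let up (i : nat) : R := 2^-1 * a i + (- 2^-1) * b i.
Let u (i : nat) : R := to_half_line (t i).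

Let t_lt i j : (i < j)%N -> (j <= n)%N -> t i < t j.
Proof. by have [_ _ _ ti _] := alt; exact: incr_lt. Qed.

Let t01 i : (i < n)%N -> 0 <= t i < 1.
Proof.
have [_ t0 tn ti _] := alt; move=> i_n.
by rewrite -{1}t0 (incr_le ti) ?(ltnW i_n) //= -tn t_lt.
Qed.

Let u0 : u 0%N = 0.
Proof. by have [_ t0 _ _ _] := alt; rewrite /u t0 /to_half_line mul0r. Qed.

Let u_lt i j : (i < j)%N -> (j < n)%N -> u i < u j.
Proof.
move=> ij jn; have /andP[j0 j1] := t01 jn.
have /andP[i0 i1] := t01 (ltn_trans ij jn).
rewrite -of_half_line_lt ?to_half_lineK //; first by apply: t_lt => //; exact: ltnW.
by rewrite divr_ge0 // subr_ge0 ltW.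
Qed.

Let u_gt0 i : (0 < i < n)%N -> 0 < u i.
Proof. by move=> /andP[i0 i_n]; rewrite -u0 u_lt. Qed.

Let homog_lo i : (i <= n)%N -> homog n alpha lo (t i)
   = (if odd (n + i) then 0 else homog n alpha a (t i)).
Proof.
have [_ _ _ _ tb] := alt; move=> i_n; rewrite homog_lin tb // -signr_odd.
by case: odd; rewrite ?expr1 ?expr0; field.
Qed.

Let homog_up i : (i <= n)%N -> homog n alpha up (t i)
   = (if odd (n + i) then homog n alpha a (t i) else 0).
Proof.
have [_ _ _ _ tb] := alt; move=> i_n; rewrite homog_lin tb // -signr_odd.
by case: odd; rewrite ?expr1 ?expr0; field.
Qed.

Let lo_zero i : (i < n)%N -> odd (n + i) -> lincomb n alpha lo (u i) = 0.
Proof.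
move=> i_n o; apply/eqP; rewrite -homog_eq0 ?t01 //.
by rewrite homog_lo ?o // ltnW.
Qed.

Let up_zero i : (i < n)%N -> ~~ odd (n + i) -> lincomb n alpha up (u i) = 0.
Proof.
move=> i_n o; apply/eqP; rewrite -homog_eq0 ?t01 //.
by rewrite homog_up ?(negPf o) // ltnW.
Qed.

Let lo_ge0 x : 0 <= x -> 0 <= lincomb n alpha lo x.
Proof.
have [fb _ _ _ _] := alt; move=> x0; have /andP[s0 s1] := of_half_line_itv x0.
have := fb (of_half_line x); rewrite s0 (ltW s1) => /(_ isT).
rewrite ler_norml => /andP[h _].
rewrite -(pmulr_rge0 _ (of_half_line_gt0 (alpha n) x0)) -homog_of_half_line // homog_lin.
by rewrite -mulrDr mulr_ge0 ?invr_ge0 //; lra.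
Qed.

Let up_ge0 x : 0 <= x -> 0 <= lincomb n alpha up x.
Proof.
have [fb _ _ _ _] := alt; move=> x0; have /andP[s0 s1] := of_half_line_itv x0.
have := fb (of_half_line x); rewrite s0 (ltW s1) => /(_ isT).
rewrite ler_norml => /andP[_ h].
rewrite -(pmulr_rge0 _ (of_half_line_gt0 (alpha n) x0)) -homog_of_half_line // homog_lin.
by rewrite mulNr -mulrBr mulr_ge0 ?invr_ge0 //; lra.
Qed.

Let lo_n : lo n = a n.
Proof.
have [_ _ tn _ _] := alt; have := homog_lo (leqnn n).
by rewrite addnn odd_double tn !homog1.
Qed.

Let up_n : up n = 0.
Proof.
have [_ _ tn _ _] := alt; have := homog_up (leqnn n).
by rewrite addnn odd_double tn !homog1.
Qed.

Let lo_0 : lo 0%N = if odd n then 0 else a 0%N.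
Proof.
have [_ t0 _ _ _] := alt; have := homog_lo (leq0n n).
by rewrite addn0 t0 !homog0.
Qed.

Let up_0 : up 0%N = if odd n then a 0%N else 0.
Proof.
have [_ t0 _ _ _] := alt; have := homog_up (leq0n n).
by rewrite addn0 t0 !homog0.
Qed.

Let alphaS_pos i : (i < n)%N -> 0 < alpha i.+1.
Proof. by move=> i_n; rewrite -{1}a0 (incr_lt incr). Qed.

(** Here a meets b at 0 and at oo, so the upper part lacks the first and the last
    term and becomes a system with 2m - 1 terms. *)
Let even_case m : n = m.*2 ->
  even_form m alpha a (lincomb n alpha lo) (lincomb n alpha up).
Proof.
move=> nE; have m0 : (0 < m)%N by lia.
have [m' mE] : exists m', m = m'.+1 by exists m.-1; lia.
have nE' : n = m'.*2.+2 by lia.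
exists (fun i => u i.*2.-1), (fun i => u i.*2).
have no : odd n = false by rewrite nE odd_double.
have x0 i : (0 < i <= m)%N -> 0 < u i.*2.-1 by move=> im; apply: u_gt0; lia.
have xi i : (0 < i < m)%N -> u i.*2.-1 < u i.+1.*2.-1 by move=> im; apply: u_lt; lia.
have loz i : (0 < i <= m)%N -> lincomb n alpha lo (u i.*2.-1) = 0.
  by move=> im; apply: lo_zero; lia.
have upz i : (i < m)%N -> lincomb n alpha up (u i.*2) = 0.
  by move=> im; apply: up_zero; lia.
have [|||||_ _ lo_neq0 loP loE] := @det_form R m alpha (fun i => u i.*2.-1) lo _ _ x0 xi.
- by rewrite -nE.
- by rewrite a0.
- by rewrite -nE; exists n => //; rewrite lo_n gt_eqF.
- by rewrite -nE.
- by rewrite -nE.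
have upS x : lincomb n alpha up x
    = lincomb m'.*2 (fun j => alpha j.+1) (fun j => up j.+1) x.
  rewrite nE' lincomb_shift ?up_0 ?no // lincomb_trunc //.
  by rewrite -nE' up_n.
have y0 i : (0 < i <= m')%N -> 0 < u i.*2 by move=> im; apply: u_gt0; lia.
have yi i : (0 < i < m')%N -> u i.*2 < u i.+1.*2 by move=> im; apply: u_lt; lia.
have [|||||upt lead _ upP upE] := @det_form R m' (fun j => alpha j.+1)
    (fun i => u i.*2) (fun j => up j.+1) _ _ y0 yi.
- by move=> i im; apply: incr; lia.
- by apply: ltW; apply: alphaS_pos.
- (* at the second alternation point the upper part equals the positive f *)
  apply: contrapT => none.
  have := homog_up (i := 1) n0.
  rewrite addn1 /= no /= => e.
  have t1 : 0 <= t 1%N <= 1.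
    by have /andP[-> /ltW ->] : 0 <= t 1%N < 1 by apply: t01; lia.
  have := hF t1; rewrite -e /homog big1 ?ltxx // => i _.
  suff -> : up i = 0 by rewrite mul0r.
  have [i0|i0] := eqVneq (i : nat) 0%N; first by rewrite i0 up_0 no.
  have [i_n|i_n] := eqVneq (i : nat) n; first by rewrite i_n up_n.
  have := ltn_ord i => im; have iS : (i : nat) = (i : nat).-1.+1 by lia.
  apply/eqP; rewrite iS; apply/negPn/negP => h; apply: none.
  by exists (i : nat).-1 => //; lia.
- by move=> x hx; rewrite -upS up_ge0.
- by move=> i im; rewrite -upS upz //; lia.
split.
- exact: u0.
- by move=> i im; apply: u_lt; lia.
- by move=> i im; apply: u_lt; lia.
- move=> x hx; split; split.
  + rewrite le_eqVlt in hx; move: hx => /orP[/eqP<-|hx]; last by rewrite nE; exact: loP.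
    rewrite lincomb_at0 // => /eqP; rewrite (negPf (lo_neq0 _ _)) //.
  + by move=> [i im ->]; exact: loz.
  + rewrite le_eqVlt in hx; move: hx => /orP[/eqP<-|hx]; first by exists 0%N.
    by rewrite upS => /(upP _ hx)[i im ->]; exists i => //; lia.
  + by move=> [i im ->]; exact: upz.
- split.
    by move=> x _; rewrite {1}nE loE (_ : lo m.*2 = a m.*2) // -nE; exact: lo_n.
  exists (up m'.*2.+1 / confluent_lead m' (fun j => alpha j.+1) (fun i => u i.*2) 0).
    by rewrite divr_gt0.
  move=> x _; rewrite upS upE mE /=; congr (_ / _ * _).
  by rewrite !confluent_leadE.
Qed.

(** Here b = - a at 0 and b = a at oo: the lower part lacks the first term and
    the upper part the last one. *)
Let odd_case m : n = m.*2.+1 ->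
  odd_form m alpha a (lincomb n alpha lo) (lincomb n alpha up).
Proof.
move=> nE; have no : odd n by rewrite nE /= odd_double.
exists (fun i => u i.-1.*2), (fun i => u i.*2.-1).
have loz i : (i <= m)%N -> lincomb n alpha lo (u i.*2) = 0.
  by move=> im; apply: lo_zero; lia.
have upz i : (0 < i <= m)%N -> lincomb n alpha up (u i.*2.-1) = 0.
  by move=> im; apply: up_zero; lia.
have loS x : lincomb n alpha lo x
    = lincomb m.*2 (fun j => alpha j.+1) (fun j => lo j.+1) x.
  by rewrite nE lincomb_shift // lo_0 no.
have upS x : lincomb n alpha up x = lincomb m.*2 alpha up x.
  by rewrite nE lincomb_trunc // -nE up_n.
have x0 i : (0 < i <= m)%N -> 0 < u i.*2 by move=> im; apply: u_gt0; lia.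
have xi i : (0 < i < m)%N -> u i.*2 < u i.+1.*2 by move=> im; apply: u_lt; lia.
have y0 i : (0 < i <= m)%N -> 0 < u i.*2.-1 by move=> im; apply: u_gt0; lia.
have yi i : (0 < i < m)%N -> u i.*2.-1 < u i.+1.*2.-1 by move=> im; apply: u_lt; lia.
have [|||||_ _ _ loP loE] := @det_form R m (fun j => alpha j.+1)
    (fun i => u i.*2) (fun j => lo j.+1) _ _ x0 xi.
- by move=> i im; apply: incr; lia.
- by apply: ltW; apply: alphaS_pos.
- by exists m.*2 => //; rewrite -nE lo_n gt_eqF.
- by move=> x hx; rewrite -loS lo_ge0.
- by move=> i im; rewrite -loS loz //; lia.
have up00 : up 0%N != 0.
  rewrite up_0 no gt_eqF // -(homog0 a incr a0).
  by apply: hF; rewrite lexx ler01.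
have [|||||upt lead up_neq0 upP upE] := @det_form R m alpha (fun i => u i.*2.-1) up _ _ y0 yi.
- by move=> i im; apply: incr; lia.
- by rewrite a0.
- by exists 0%N.
- by move=> x hx; rewrite -upS up_ge0.
- by move=> i im; rewrite -upS upz.
split.
- exact: u0.
- by move=> i im; apply: u_lt; lia.
- by move=> i im /=; apply: u_lt; lia.
- move=> x hx; split; split.
  + rewrite le_eqVlt in hx; move: hx => /orP[/eqP<-|hx]; first by exists 1%N.
    by rewrite loS => /(loP _ hx)[i im ->]; exists i.+1 => //; lia.
  + by move=> [i im ->]; apply: loz; lia.
  + rewrite le_eqVlt in hx; move: hx => /orP[/eqP<-|hx].
      by rewrite lincomb_at0 // => /eqP; rewrite (negPf up00).
    by rewrite upS; exact: upP.
  + by move=> [i im ->]; exact: upz.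
- split.
    by move=> x _; rewrite loS loE (_ : lo m.*2.+1 = a m.*2.+1) // -nE; exact: lo_n.
  exists (up m.*2 / confluent_lead m alpha (fun i => u i.*2.-1) 0).
    by rewrite divr_gt0.
  move=> x _; rewrite upS upE; congr (_ / _ * _).
  by rewrite !confluent_leadE.
Qed.

Lemma decomposition_of_alternates :
  is_decomposition n alpha a
    (lincomb n alpha (fun i => 2^-1 * a i + 2^-1 * b i))
    (lincomb n alpha (fun i => 2^-1 * a i + (- 2^-1) * b i)).
Proof.
split.
- by split; [exists lo|exists up].
- by move=> x hx; split; [exact: lo_ge0|exact: up_ge0].
- by move=> x _; rewrite !lincomb_lin; field.
- exact: even_case.
- exact: odd_case.
Qed.

End Decomposition.
Lemma lincomb_inj (R : realType) (n : nat) (al b c : nat -> R) :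
    (forall i, (i < n)%N -> al i < al i.+1) ->
    (forall t, 0 <= t -> lincomb n al b t = lincomb n al c t) ->
  forall i, (i <= n)%N -> b i = c i.
Proof.
move=> incr bc i i_n; apply/eqP; rewrite -subr_eq0; apply/eqP.
apply: (lincomb_eq0_coef (b := fun i => b i - c i) incr _ i_n).
by move=> t t0; rewrite lincombB bc // subrr.
Qed.

(** At a zero of one part the difference of the parts equals plus or minus their
    sum; at oo the upper part vanishes because it has no leading term. *)
Lemma alternates_of_points (R : realType) (n : nat) (alpha a bl bu u : nat -> R) :
    (0 < n)%N -> (forall i, (i < n)%N -> alpha i < alpha i.+1) -> alpha 0%N = 0 ->
    (forall t, 0 <= t -> 0 <= lincomb n alpha bl t) ->
    (forall t, 0 <= t -> 0 <= lincomb n alpha bu t) ->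
    (forall i, (i <= n)%N -> a i = bl i + bu i) -> bu n = 0 ->
    u 0%N = 0 -> (forall i, (i.+1 < n)%N -> u i < u i.+1) ->
    (forall i, (i < n)%N -> odd (n + i) -> lincomb n alpha bl (u i) = 0) ->
    (forall i, (i < n)%N -> ~~ odd (n + i) -> lincomb n alpha bu (u i) = 0) ->
  alternates n alpha a (fun i => bl i - bu i)
    (fun i => if i == n then 1 else of_half_line (u i)).
Proof.
move=> n0 incr a0 bl0 bu0 asum bun u0 ui blz buz.
have a0' : 0 <= alpha 0%N by rewrite a0.
have upos i : (i < n)%N -> 0 <= u i.
  elim: i => [|i IH] i_n; first by rewrite u0.
  by apply: le_trans (IH (ltnW i_n)) _; apply/ltW/ui.
have aE s : homog n alpha a s = homog n alpha bl s + homog n alpha bu s.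
  rewrite -[homog n alpha bl s]mul1r -[homog n alpha bu s]mul1r -homog_lin.
  by apply: eq_bigr => i _; rewrite asum ?leq_ord // !mul1r.
have cE s : homog n alpha (fun i => bl i - bu i) s
    = homog n alpha bl s - homog n alpha bu s by exact: homogB.
split.
- move=> s s01; rewrite aE cE ler_norml.
  have := homog_ge0 incr a0' bl0 s01; have := homog_ge0 incr a0' bu0 s01.
  by move=> *; apply/andP; split; lra.
- by rewrite ltn_eqF // u0 /of_half_line mul0r.
- by rewrite eqxx.
- move=> i i_n; rewrite ltn_eqF //.
  have /andP[s0 s1] := of_half_line_itv (upos i i_n).
  case: eqVneq => [//|ne]; have i1 : (i.+1 < n)%N by lia.
  rewrite of_half_line_lt ?of_half_lineK ?upos //; exact: ui.
- move=> i; rewrite leq_eqVlt => /orP[/eqP->|i_n].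
    rewrite eqxx addnn -signr_odd odd_double expr0 mul1r cE aE !homog1 //.
    by rewrite bun subr0 addr0.
  rewrite ltn_eqF // cE aE !homog_of_half_line ?upos // -signr_odd.
  have [io|io] := boolP (odd (n + i)); first by rewrite blz //; ring.
  by rewrite buz //; ring.
Qed.

Section Alternation.
Variables (R : realType) (n : nat) (alpha a : nat -> R) (hl hu : R -> R).
Hypotheses (n0 : (0 < n)%N)
  (incr : forall i, (i < n)%N -> alpha i < alpha i.+1) (a0 : alpha 0%N = 0)
  (dec : is_decomposition n alpha a hl hu).

(** The determinant for the upper part does not involve t ^ alpha_n. *)
Let upper_top (bu : nat -> R) :
  (forall t, 0 <= t -> hu t = lincomb n alpha bu t) -> bu n = 0.
Proof.
have [_ _ _ ev od] := dec; move=> huE.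
have [m [nE|nE]] : exists m, n = m.*2 \/ n = m.*2.+1.
  by exists n./2; have := odd_double_half n; case: odd; lia.
- have [x [y [_ _ _ _ [_ [c _ huD]]]]] := ev m nE.
  have [m' mE] : exists m', m = m'.+1 by exists m.-1; lia.
  have nE' : n = m'.*2.+2 by lia.
  pose g j := c * det_coef m' (fun j => alpha j.+1) y j.
  pose gg i := if i is j.+1 then if (j <= m'.*2)%N then g j else 0 else 0.
  have ggn : gg m'.*2.+2 = 0 by rewrite /= ltnn.
  have -> : bu n = gg n; last by rewrite nE'.
  apply: (lincomb_inj incr) => // t t0; rewrite -huE // huD // det_confluentE mE /= nE'.
  rewrite lincomb_shift // lincomb_trunc // /lincomb mulr_sumr.
  by apply: eq_bigr => j _; rewrite mulrA /= -ltnS ltn_ord.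
- have [x [y [_ _ _ _ [_ [c _ huD]]]]] := od m nE.
  pose g j := c * det_coef m alpha y j.
  pose gg i := if (i <= m.*2)%N then g i else 0.
  have ggn : gg m.*2.+1 = 0 by rewrite /gg ltnn.
  have -> : bu n = gg n; last by rewrite nE.
  apply: (lincomb_inj incr) => // t t0; rewrite -huE // huD // det_confluentE nE.
  rewrite lincomb_trunc // /lincomb mulr_sumr.
  by apply: eq_bigr => j _; rewrite mulrA /gg -ltnS ltn_ord.
Qed.

(** The zeros of the two parts, merged in increasing order. *)
Let zeros : exists u : nat -> R, [/\ u 0%N = 0,
  (forall i, (i.+1 < n)%N -> u i < u i.+1),
  (forall i, (i < n)%N -> odd (n + i) -> 0 <= u i -> hl (u i) = 0) &
  (forall i, (i < n)%N -> ~~ odd (n + i) -> 0 <= u i -> hu (u i) = 0)].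
Proof.
have [_ _ _ ev od] := dec.
have [m [nE|nE]] : exists m, n = m.*2 \/ n = m.*2.+1.
  by exists n./2; have := odd_double_half n; case: odd; lia.
- have [x [y [y0 yx xy hz _]]] := ev m nE.
  exists (fun i => if odd i then x i./2.+1 else y i./2); split => //.
  + move=> i i_n /=; case: ifPn => oi.
      by rewrite /= uphalf_half oi add1n; apply: xy; lia.
    rewrite /= uphalf_half (negPf oi) add0n.
    by apply: (yx i./2.+1); lia.
  + move=> i i_n; rewrite nE oddD odd_double /= => oi; rewrite oi => xp.
    by apply/(hz _ xp).1; exists i./2.+1 => //; lia.
  + move=> i i_n; rewrite nE oddD odd_double /= => oi; rewrite (negPf oi) => yp.
    by apply/(hz _ yp).2; exists i./2 => //; lia.
- have [x [y [x1 xy yx hz _]]] := od m nE.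
  exists (fun i => if odd i then y i./2.+1 else x i./2.+1); split => //.
  + move=> i i_n /=; case: ifPn => oi.
      by rewrite /= uphalf_half oi add1n; apply: yx; lia.
    rewrite /= uphalf_half (negPf oi) add0n.
    by apply: xy; lia.
  + move=> i i_n; rewrite nE oddD /= odd_double /= => oi; rewrite (negPf oi) => xp.
    by apply/(hz _ xp).1; exists i./2.+1 => //; lia.
  + move=> i i_n; rewrite nE oddD /= odd_double /= negbK => oi; rewrite oi => yp.
    by apply/(hz _ yp).2; exists i./2.+1 => //; lia.
Qed.

Lemma alternates_of_decomposition :
  exists c t, alternates n alpha a c t /\
    forall x, 0 <= x -> hl x - hu x = lincomb n alpha c x.
Proof.
have [[[bl hlE] [bu huE]] h0 hsum _ _] := dec.
have [u [u0 ui lz uz]] := zeros.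
have upos i : (i < n)%N -> 0 <= u i.
  elim: i => [|i IH] i_n; first by rewrite u0.
  by apply: le_trans (IH (ltnW i_n)) _; apply/ltW/ui.
exists (fun i => bl i - bu i).
exists (fun i => if i == n then 1 else of_half_line (u i)); split; last first.
  by move=> x x0; rewrite lincombB hlE ?huE.
apply: alternates_of_points => //.
- by move=> t t0; rewrite -hlE //; have [] := h0 t t0.
- by move=> t t0; rewrite -huE //; have [] := h0 t t0.
- move=> i i_n.
  have -> : a i = 1 * bl i + 1 * bu i; last by rewrite !mul1r.
  apply: (lincomb_inj (c := fun i => 1 * bl i + 1 * bu i) incr) => // t t0.
  by rewrite hsum // lincomb_lin !mul1r hlE ?huE.
- exact: upper_top.
- by move=> i i_n o; rewrite -hlE ?lz ?upos.
- by move=> i i_n o; rewrite -huE ?uz ?upos.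
Qed.

End Alternation.

Theorem theorem5p3p3 (R : realType) (n : nat) (hn : (0 < n)%N)
    (alpha : nat -> R) (halpha0 : alpha 0%N = 0)
    (halpha : forall i : nat, (i < n)%N -> alpha i < alpha i.+1)
    (a : nat -> R)
    (hpos : forall t : R, 0 <= t -> 0 < lincomb n alpha a t)
    (han : 0 < a n) :
  exists gl gu : R -> R,
    is_decomposition n alpha a gl gu /\
    (forall hl hu : R -> R, is_decomposition n alpha a hl hu ->
       forall t : R, 0 <= t -> hl t = gl t /\ hu t = gu t).
Proof.
have hF := homog_gt0 halpha hpos han.
have [b [t alt]] := exists_alternates hn halpha halpha0 hF.
exists (lincomb n alpha (fun i => 2^-1 * a i + 2^-1 * b i)).
exists (lincomb n alpha (fun i => 2^-1 * a i + (- 2^-1) * b i)).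
split; first exact: (decomposition_of_alternates hn halpha halpha0 hF han alt).
move=> hl hu dec x x0.
have [c [u [altc hE]]] := alternates_of_decomposition hn halpha halpha0 dec.
have bc := alternates_unique hn halpha halpha0 hF alt altc.
have [_ _ hsum _ _] := dec.
have e : hl x - hu x = lincomb n alpha b x.
  by rewrite hE //; apply: eq_bigr => i _; rewrite bc // leq_ord.
by rewrite !lincomb_lin hsum // -e; split; field.
Qed.
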